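(* Let $D=\mathbb{R}^2\setminus\{(c,\tilde c):\tilde c<0 \text{ and } c\in[\tilde c,0]\}$, let $(c,\tilde c)\in D$, let $f\colon M^n(c)\to\mathbb{Q}^{n+p}(\tilde c)$ be an isometric immersion of a Riemannian manifold of constant sectional curvature $c$ and let $\mathcal{R}_{\varphi,\beta,\Omega,L}(f)\colon\tilde M^n\to\mathbb{Q}^{n+p}(\tilde c)$ be an $L$-transform of $f$. Assume that $L$ decomposes as $L=L_1\oplus L_2$ with respect to an orthogonal decomposition $V=V_1\oplus V_2$. For $1\le i,j\le2$ define $$\varphi_j=\pi_{V_j}\circ\varphi,\qquad \beta_j=\beta|_{V_j},\qquad \Omega_{ij}=\pi_{V_i}\circ\Omega|_{V_j},$$ where $\pi_{V_j}\colon V\to V_j$ is the orthogonal projection, and for $i\neq j$ $$\bar\varphi_i=\varphi_i-\Omega_{ij}\Omega_{jj}^{-1}\varphi_j,\quad \bar\beta_i=\mathcal{P}_j\bigl(\beta_i-\beta_j(\Omega_{jj}^{-1})^t\Omega_{ij}^t\bigr),\quad \bar\Omega_{ii}=\Omega_{ii}-\Omega_{ij}\Omega_{jj}^{-1}\Omega_{ji},$$ where $\mathcal{P}_j=I-\mathcal{G}_j\Omega_{jj}^{-1}\mathcal{G}_j^t$ and $\mathcal{G}_j=F_*\omega_j^t+i_*\beta_j+\tilde cF\varphi_j^t$, $\omega_j=d\varphi_j$. Then $(\varphi_j,\beta_j,\Omega_{jj},L_j)$ defines an $L_j$-transform $f_j=\mathcal{R}_{\varphi_j,\beta_j,\Omega_{jj},L_j}(f)$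 of $f$ for $1\le j\le2$ (in particular $\Omega_{jj}$ is invertible), $(\bar\varphi_i,\bar\beta_i,\bar\Omega_{ii},L_i)$ defines an $L_i$-transform of $f_j$ for $1\le i\neq j\le2$, and $$\mathcal{R}_{\varphi,\beta,\Omega,L}(f)=\mathcal{R}_{\bar\varphi_i,\bar\beta_i,\bar\Omega_{ii},L_i}\bigl(\mathcal{R}_{\varphi_j,\beta_j,\Omega_{jj},L_j}(f)\bigr).$$ The same conclusion holds if $(c,\tilde c)\notin D$, as long as $\Omega_{jj}$ is invertible for $1\le j\le2$.
   Context: $\mathbb{Q}^{n+p}(\tilde c)=\mathbb{Q}^{n+p}_0(\tilde c)$, where $\mathbb{Q}^{n+p}_s(\tilde c)$ is the pseudo-Riemannian space form of dimension $n+p$, index $s$ and constant sectional curvature $\tilde c$; $i\colon \mathbb{Q}^{n+p}_s(\tilde c)\to\mathbb{R}^{n+p+1}_{s+\epsilon_0}$ is the umbilical inclusion ($\epsilon_0=0$ if $\tilde c>0$, $\epsilon_0=1$ if $\tilde c<0$), and $F=i\circ f$; if $\tilde c=0$ then $\mathbb{Q}^{n+p}_s(0)=\mathbb{R}^{n+p}_s$, $i$ is the identity and $F=f$. For an isometric immersion $f$ of a Riemannian manifold $M^n$, $N_fM$ is the normal bundle, $\nabla^\perp$ the normal connection, $\alpha$ the second fundamental form, $A_\xi$ the shape operators, and $A(X)\xi=A_\xi X$. The superscript $t$ denotes the transpose with respect to the relevant inner products. Normal vectors of $f$ (or of a transform) are identified with their images under $i_*$ when $\mathcal{P}_j$ is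 applied to them. Vectorial Ribaucour transform. Let $V$ be a (finite-dimensional) Euclidean vector space, identified with the trivial bundle $M\times V$ with its flat connection; $V^*\otimes V$ is identified with the endomorphisms of $V$. Let $\varphi\colon M\to V$ be smooth, $\omega=d\varphi$, $\omega^t\in\Gamma(V^*\otimes TM)$ given by $\langle\omega^t(v),X\rangle=\langle v,\omega(X)\rangle$, $\varphi^t(v)=\langle\varphi,v\rangle$, and let $\beta\in\Gamma(V^*\otimes N_fM)$ satisfy, for all $X$ and $u,v$, $\alpha(X,\omega^t(v))+(\nabla_X\beta)v=0$ (where $(\nabla_X\beta)v=\nabla^\perp_X(\beta(v))-\beta(\nabla_X v)$) and $[\Phi_u,\Phi_v]=0$, where $\Phi_vX=\Phi(X)(v)=(\nabla_X\omega^t)v-A_{\beta(v)}X+\tilde c\,\varphi^t(v)X$. Put $\mathcal{G}=F_*\omega^t+i_*\beta+\tilde cF\varphi^t$, and let $\Omega\in\Gamma(V^*\otimes V)$ be everywhere invertible with $d\Omega=\mathcal{G}^td\mathcal{G}$ (equivalently $d\Omega(X)=\omega\,\Phi(X)$) and $\Omega+\Omega^t=\mathcal{G}^t\mathcal{G}$. The vectorial Ribaucour transform $\tilde f=\mathcal{R}_{\varphi,\beta,\Omega}(f)\colon\tilde M^n\to\mathbb{Q}^{n+p}_s(\tilde c)$ is defined by $i\circ\tilde f=F-\mathcal{G}\Omega^{-1}\varphi$, where $\tilde M^n\subset M^n$ is the set of regular points of $\tilde f$ endowed with the induced metric. $L$-transform. If $f\colon M^n(c)\to \mathbb{Q}^{n+p}_s(\tilde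 c)$, $\tilde f=\mathcal{R}_{\varphi,\beta,\Omega}(f)$ is an $L$-transform of $f$, written $\mathcal{R}_{\varphi,\beta,\Omega,L}(f)$, if $L\in V^*\otimes V$ satisfies $\Phi(Y)L+A(Y)\beta+(c-\tilde c)Y\varphi^t=0$ for all tangent $Y$ and $\Omega L+L^t\Omega^t=\rho$, where $\rho=\beta^t\beta-(c-\tilde c)\varphi\varphi^t$.
   Formalization: For (c,c̃) in D the formal theorem also assumes 𝒢 is injective on each V_j at every point, or that Ω_jj is invertible: without it Ω_jj can be singular (e.g. φ=0, β=0, L=0, Ω a rotation by 90°). For c̃<0 the space form is the full two-sheeted quadric. *)

(* Defs.v *)
From HB Require Import structures.
From mathcomp Require Import all_boot all_order all_algebra.
From mathcomp Require Import all_classical all_reals.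
From mathcomp Require Import topology normedtype derive.

Set Implicit Arguments.
Unset Strict Implicit.
Unset Printing Implicit Defensive.

Import Order.TTheory GRing.Theory Num.Theory.
Import numFieldTopology.Exports numFieldNormedType.Exports.

Local Open Scope classical_set_scope.
Local Open Scope ring_scope.

(* C^oo on an open set: every iterated partial derivative is differentiable. *)
Definition partial (R : realType) (n : nat) (i : 'I_n) (h : 'cV[R]_n -> R) :
  'cV[R]_n -> R := fun x => 'D_(delta_mx i 0) h x.

Definition smooth_on (R : realType) (n : nat) (U : set 'cV[R]_n)
  (h : 'cV[R]_n -> R) : Prop :=
  forall (s : seq 'I_n) (x : 'cV[R]_n), U x ->
    differentiable (foldr (@partial R n) h s) x.

(* [cmap k] and [cinv k] are total functions, but only their restrictions to
   [cdom k] and to [cmap k @` cdom k] are meaningful. [chart_at] merely selects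
   a chart around each point. *)
Record manifold (R : realType) (n : nat) := Manifold {
  carrier :> topologicalType;
  chart : Type;
  cdom : chart -> set carrier;
  cmap : chart -> carrier -> 'cV[R]_n;
  cinv : chart -> 'cV[R]_n -> carrier;
  chart_at : carrier -> chart;
  manifold_hausdorff : hausdorff_space carrier;
  manifold_second_countable : @second_countable carrier;
  cdom_open : forall k, open (cdom k);
  cimg_open : forall k, open (cmap k @` cdom k);
  cmapK : forall k x, cdom k x -> cinv k (cmap k x) = x;
  cmap_continuous : forall k x, cdom k x -> {for x, continuous (cmap k)};
  cinv_continuous : forall k u, (cmap k @` cdom k) u ->
    {for u, continuous (cinv k)};
  chart_atP : forall x, cdom (chart_at x) x;
  transition_smooth : forall k l (i : 'I_n),
    smooth_on (cmap k @` (cdom k `&` cdom l)) (fun u => cmap l (cinv k u) i 0)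
}.

Section Calculus.
Context {R : realType} {n : nat} {M : manifold R n}.
Implicit Types (k l : chart M) (S : set M) (x : M) (X Y Z : 'cV[R]_n).

Definition smooth a b S (H : M -> 'M[R]_(a, b)) : Prop :=
  forall k s t,
    smooth_on (cmap k @` (cdom k `&` S)) (fun u => H (cinv k u) s t).

(* Tangent vectors at a point of [cdom k] are given by their components in the
   coordinate frame of [k]; [dir k X H x] is the derivative X(H) at x. *)
Definition dir a b k X (H : M -> 'M[R]_(a, b)) x : 'M[R]_(a, b) :=
  \matrix_(s, t) 'D_X (fun u => H (cinv k u) s t) (cmap k x).

(* The matrix of the differential of H, i.e. dH(X) = jac k H x *m X. *)
Definition jac a k (H : M -> 'cV[R]_a) x : 'M[R]_(a, n) :=
  \matrix_(s, i) dir k (delta_mx i 0) H x s 0.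

(* A metric is given by its Gram matrices: [g k x] is the matrix of the inner
   product of T_x M in the coordinate frame of the chart [k]. *)
Definition metric_field := chart M -> M -> 'M[R]_n.

Implicit Type g : metric_field.

Definition gdot g k x X Y : R := (X^T *m g k x *m Y) 0 0.

Definition riemannian_metric S g : Prop :=
  [/\ forall k s t, smooth_on (cmap k @` (cdom k `&` S))
        (fun u => g k (cinv k u) s t),
      forall k x, (cdom k `&` S) x -> (g k x)^T = g k x,
      forall k x X, (cdom k `&` S) x -> X != 0 -> 0 < gdot g k x X X &
      forall k l x, (cdom k `&` cdom l `&` S) x ->
        g k x = (jac k (cmap l) x)^T *m g l x *m jac k (cmap l) x].

Definition christoffel g k x (a i j : 'I_n) : R :=
  let dg (i j b : 'I_n) := dir k (delta_mx i 0) (g k) x j b in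
  2^-1 * \sum_b invmx (g k x) a b * (dg i j b + dg j i b - dg b i j).

(* Levi-Civita covariant derivative of the vector fields that are the columns
   of Y, given by their components in the chart [k]. *)
Definition nabla q g k X (Y : M -> 'M[R]_(n, q)) x : 'M[R]_(n, q) :=
  dir k X Y x +
  (\matrix_(a, j) \sum_i X i 0 * christoffel g k x a i j) *m Y x.

(* R(X,Y)Z, computed with the extensions of X, Y, Z having constant components
   in the chart, for which [X,Y] = 0. *)
Definition curvature g k X Y Z x : 'cV[R]_n :=
  nabla g k X (nabla g k Y (fun=> Z)) x - nabla g k Y (nabla g k X (fun=> Z)) x.

Definition constant_curvature S g (c : R) : Prop :=
  forall k x X Y, (cdom k `&` S) x ->
    gdot g k x (curvature g k X Y Y x) X =
    c * (gdot g k x X X * gdot g k x Y Y - gdot g k x X Y ^+ 2).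

(* For w = d phi with phi : M -> R^m, this is w^t : R^m -> T_x M, determined by
   <w^t(v), X> = <v, w(X)>; its columns are the gradients of the components of
   phi. *)
Definition omega_t m g (phi : M -> 'cV[R]_m) k x : 'M[R]_(n, m) :=
  invmx (g k x) *m (jac k phi x)^T.

End Calculus.

Arguments metric_field {R n} M.

(* The ambient space of the space form of dimension n + p and curvature ct:
   R^(n+p) if ct = 0, R^(n+p+1) if ct > 0, and the Lorentz space R^(n+p+1)_1
   (timelike coordinate of index 0) if ct < 0. *)
Definition ambient_dim (R : realType) (n p : nat) (ct : R) : nat :=
  n + p + (ct != 0).

Definition ambient_gram (R : realType) (ct : R) (N : nat) : 'M[R]_N :=
  diag_mx (\row_i (if (ct < 0) && (i == 0 :> nat) then -1 else 1)).

(* The transpose of a linear map from a Euclidean space R^q to the ambient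
   space. *)
Definition adj (R : realType) (ct : R) (N q : nat) (H : 'M[R]_(N, q)) :
  'M[R]_(q, N) := H^T *m ambient_gram ct N.

Definition adot (R : realType) (ct : R) (N : nat) (u v : 'cV[R]_N) : R :=
  (adj ct u *m v) 0 0.

(* The image of the umbilical inclusion. For ct < 0 this is the whole quadric,
   with its two (isometric) sheets: transforms can exchange the sheets. *)
Definition space_form (R : realType) (n p : nat) (ct : R) :
  set 'cV[R]_(ambient_dim n p ct) :=
  [set u | ct != 0 -> adot ct u u = ct^-1].

Section Submanifolds.
Context {R : realType} {n p : nat} (c ct : R) {M : manifold R n}.
Local Notation N := (ambient_dim n p ct).
Implicit Types (k : chart M) (S : set M) (g : metric_field M) (x : M).
Implicit Types (X Y : 'cV[R]_n) (F : M -> 'cV[R]_N).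

Definition induced_metric F : metric_field M :=
  fun k x => adj ct (jac k F x) *m jac k F x.

(* An immersion f into the space form is represented by F = i o f, and normal
   vectors of f by their images under i_*. *)
Definition isometric_immersion S g F : Prop :=
  [/\ open S, riemannian_metric S g, smooth S F,
      forall x, S x -> space_form (F x) &
      forall k x, (cdom k `&` S) x -> induced_metric F k x = g k x].

Definition regular_points F : set M :=
  [set x | \rank (jac (chart_at x) F x) = n].

(* Gauss formula: i_* of the ambient connection is the flat derivative plus
   ct <X,Y> F. *)
Definition alpha g F k X Y x : 'cV[R]_N :=
  dir k X (fun y => jac k F y *m Y) x - jac k F x *m nabla g k X (fun=> Y) x
  + (ct * gdot g k x X Y) *: F x.

(* <A_xi X, Y> = <alpha(X,Y), xi> *)
Definition shape_op g F k x (xi : 'cV[R]_N) : 'M[R]_n :=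
  invmx (g k x) *m
  \matrix_(j, i) adot ct (alpha g F k (delta_mx i 0) (delta_mx j 0) x) xi.

(* Weingarten formula for a normal vector field xi. *)
Definition nabla_perp g F k X (xi : M -> 'cV[R]_N) x : 'cV[R]_N :=
  dir k X xi x + jac k F x *m (shape_op g F k x (xi x) *m X).

Definition normal_to F k x q (B : 'M[R]_(N, q)) : Prop :=
  adj ct (jac k F x) *m B = 0 /\ (ct != 0 -> adj ct (F x) *m B = 0).

Section Transform.
Context {m : nat} (S : set M) (g : metric_field M) (F : M -> 'cV[R]_N).
Context (phi : M -> 'cV[R]_m) (beta : M -> 'M[R]_(N, m)).
Context (Omega : M -> 'M[R]_m) (L : 'M[R]_m).
Implicit Types u v : 'cV[R]_m.

(* Phi(X)v = Phi_v X *)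
Definition Phi k x X v : 'cV[R]_n :=
  nabla g k X (fun y => omega_t g phi k y *m v) x
  - shape_op g F k x (beta x *m v) *m X
  + (ct * ((phi x)^T *m v) 0 0) *: X.

(* Independent of the chart used to compute F_* w^t. *)
Definition calG x : 'M[R]_(N, m) :=
  let k := chart_at x in
  jac k F x *m omega_t g phi k x + beta x + ct *: (F x *m (phi x)^T).

(* i o R_{phi,beta,Omega}(f), as a function on the domain S of f; the transform
   itself is its restriction to [S `&` regular_points transform]. *)
Definition transform x : 'cV[R]_N :=
  F x - calG x *m invmx (Omega x) *m phi x.

Definition ribaucour_data : Prop :=
  [/\ smooth S phi, smooth S beta, smooth S Omega,
      forall k x, (cdom k `&` S) x -> normal_to F k x (beta x) &
      forall k x, (cdom k `&` S) x ->
      [/\ forall X v,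
            alpha g F k X (omega_t g phi k x *m v) x
            + nabla_perp g F k X (fun y => beta y *m v) x = 0,
          forall X u v,
            Phi k x (Phi k x X v) u - Phi k x (Phi k x X u) v = 0,
          Omega x \in unitmx,
          forall X, dir k X Omega x = adj ct (calG x) *m dir k X calG x &
          Omega x + (Omega x)^T = adj ct (calG x) *m calG x]].

(* f : S -> Q^{n+p}(ct) is an isometric immersion of the manifold S of constant
   curvature c, with metric g, and (phi, beta, Omega, L) defines an L-transform
   of f. *)
Definition L_transform_data : Prop :=
  [/\ isometric_immersion S g F, constant_curvature S g c, ribaucour_data,
      forall k x X v, (cdom k `&` S) x ->
        Phi k x X (L *m v) + shape_op g F k x (beta x *m v) *m X
        + ((c - ct) * ((phi x)^T *m v) 0 0) *: X = 0 &
      forall x, S x ->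
        Omega x *m L + L^T *m (Omega x)^T =
        adj ct (beta x) *m beta x - (c - ct) *: (phi x *m (phi x)^T)].

End Transform.
End Submanifolds.

Definition admissible (R : realType) (c ct : R) : Prop :=
  ~ (ct < 0 /\ ct <= c <= 0).

(* An orthogonal decomposition of V = R^m as V_0 + V_1, where V_j is the image
   of the isometric embedding E j : R^(d j) -> R^m (an orthonormal basis of
   V_j, by which V_j is identified with R^(d j)); the orthogonal projection
   onto V_j is then (E j)^T, and the restriction to V_j is composition with
   E j. *)
Definition orthogonal_decomposition (R : realType) (m : nat) (d : 'I_2 -> nat)
  (E : forall j, 'M[R]_(m, d j)) : Prop :=
  [/\ forall j, (E j)^T *m E j = 1%:M,
      forall i j, i != j -> (E i)^T *m E j = 0 &
      \sum_j E j *m (E j)^T = 1%:M].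

Section Decomposition.
Context {R : realType} {n p : nat} (ct : R) {M : manifold R n}.
Local Notation N := (ambient_dim n p ct).
Context {m : nat} (d : 'I_2 -> nat) (E : forall j, 'M[R]_(m, d j)).
Context (g : metric_field M) (F : M -> 'cV[R]_N).
Context (phi : M -> 'cV[R]_m) (beta : M -> 'M[R]_(N, m)).
Context (Omega : M -> 'M[R]_m).
Implicit Types i j : 'I_2.

Definition phi_ j (x : M) : 'cV[R]_(d j) := (E j)^T *m phi x.

Definition beta_ j (x : M) : 'M[R]_(N, d j) := beta x *m E j.

Definition Omega_ i j (x : M) : 'M[R]_(d i, d j) :=
  (E i)^T *m Omega x *m E j.

Definition calG_ j (x : M) : 'M[R]_(N, d j) :=
  calG g F (phi_ j) (beta_ j) x.

Definition calP j (x : M) : 'M[R]_N :=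
  1%:M - calG_ j x *m invmx (Omega_ j j x) *m adj ct (calG_ j x).

Definition transform_ j : M -> 'cV[R]_N :=
  transform g F (phi_ j) (beta_ j) (Omega_ j j).

Definition phi_bar i j (x : M) : 'cV[R]_(d i) :=
  phi_ i x - Omega_ i j x *m invmx (Omega_ j j x) *m phi_ j x.

Definition beta_bar i j (x : M) : 'M[R]_(N, d i) :=
  calP j x *m
  (beta_ i x - beta_ j x *m (invmx (Omega_ j j x))^T *m (Omega_ i j x)^T).

Definition Omega_bar i j (x : M) : 'M[R]_(d i) :=
  Omega_ i i x - Omega_ i j x *m invmx (Omega_ j j x) *m Omega_ j i x.

End Decomposition.

(* Main.v *)
Require Import Defs.
From HB Require Import structures.
From mathcomp Require Import all_boot all_order all_algebra.
From mathcomp Require Import all_classical all_reals.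
From mathcomp Require Import topology normedtype landau derive.
From mathcomp Require Import ring lra.

Set Implicit Arguments.
Unset Strict Implicit.
Unset Printing Implicit Defensive.

Import Order.TTheory GRing.Theory Num.Theory.
Import numFieldTopology.Exports numFieldNormedType.Exports.
Local Open Scope classical_set_scope.
Local Open Scope ring_scope.

(** The proof turns the geometry into identities between matrix fields on a
    chart. Write T = dF, T^ for its adjoint, and G for the matrix of the map
    [calG]. The tangential and normal parts of the flat derivative of G are
    Phi and the left-hand side of the first Ribaucour condition, so that an
    L-transform amounts to
      D_X G = T Phi_X,   [Phi_u, Phi_v] = 0,   D Omega = G^ DG,
      Omega + Omega^T = G^ G,
    and two equations for L ([L_transform_reduced], [reduced_L_transform]).

    For an orthonormal basis a of V_j put Q = a (a^T Omega a)^-1 a^T, so that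
    the transform by V_j is F' = F - G Q phi. All that is used of Q is
      Q^T Omega Q = Q Omega Q^T = Q^T,   DQ = - Q (D Omega) Q,
      L Q^T = Q Omega L Q^T,
    the last one because V_j is invariant under L. The first two identities
    and Omega + Omega^T = G^ G make P = 1 - G Q G^ an isometry ([transPdP]),
    and then dF' = P T D with D X = X - Phi_X Q phi ([dir_transF]). Hence F' is
    regular exactly where D is invertible, its metric is D^T g D, and its
    normal space is the image under P of the normal space of F.

    The induced metric of F' has curvature c again. By the Gauss equation this
    concerns the normal part of the second derivative of F', which is
      P (N(X, D Y) + nu Q^T Phi_X^T g D Y),
    where N is the one of F and nu = beta + ct F phi^T ([normal_part_transF]).
    The two L-equations express nu^ N and nu^ nu through Phi, Omega, L and
    phi. Inserting this, all terms containing L cancel, and what remains is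
    c times the products of the metric of F' ([ip_transformed],
    [curvature_transF]).

    The remaining data, on the other summand with basis b, are
      phi' = B^T phi,  beta' = P beta B,  Omega' = b^T (Omega - Omega Q Omega) b
    with B = (1 - Q^T Omega^T) b. Their map G' is P G B = G C with
    C = (1 - Q Omega) b, whence D_X G' = P T Phi_X C. So the Phi of F' is
    D^-1 Phi_X C, and every condition for F' follows from the one for F
    ([reduced_transF]). As Omega' is the Schur complement of a^T Omega a in
    Omega, the block formula Omega^-1 = Q + C Omega'^-1 B^T ([invmx_schur])
    says precisely that the two transforms compose to the given one.

    Finally, let (c, ct) be admissible and suppose that w kills a^T Omega a
    from the left. With u = a w, the equations for Omega + Omega^T and for
    Omega L + L^T Omega^T give |G u|^2 = 0 and
    |beta u|^2 = (c - ct) <phi, u>^2. Splitting G u into its tangential part,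
    beta u and its component along F, one finds that admissibility forces
    G u = 0, hence w = 0 as G is injective on V_j ([restricted_Omega_unit]). *)

(** * Symmetry of second derivatives *)

Section Schwarz.
Context {R : realType} {V : normedModType R}.
Implicit Types (f : V -> R) (a u v w : V).

Lemma is_derive_line f a v (s : R) : differentiable f (a + s *: v) ->
  is_derive s (1 : R) (fun t : R => f (a + t *: v)) ('D_v f (a + s *: v)).
Proof.
move=> df.
have dl : is_diff s (fun t : R => a + t *: v) (fun t => t *: v).
  have := is_diffD (is_diff_cst a s) (is_diff_scalel s v).
  by rewrite add0r.
have dfl : differentiable (f \o (fun t : R => a + t *: v)) s.
  exact: differentiable_comp.
apply: DeriveDef; first exact: diff_derivable.
rewrite -[fun t : R => _]/(f \o (fun t : R => a + t *: v)).
by rewrite !deriveE// diff_comp// [in LHS]diff_val /= scale1r.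
Qed.

Lemma diff_approx f u : differentiable f u -> forall e, 0 < e ->
  \forall h \near (0 : V), `|f (u + h) - f u - 'd f u h| <= e * `|h|.
Proof.
move=> df e e0; near=> h; rewrite (diff_locallyxC df) -[f u + _ + _]addrA.
rewrite [f u + _]addrC addrK addrAC subrr add0r.
by near: h; apply: littleoP.
Unshelve. all: by end_near. Qed.

Let sdiff f u v w (t : R) :=
  f (u + t *: v + t *: w) - f (u + t *: v) - f (u + t *: w) + f u.

(* The mean value theorem along v reduces the second difference to the value
   of t * (h (u + s v + t w) - h (u + s v)) at some s < t, where h = D_v f; both
   values of h are then approximated to first order at the single point u.
   The constant K bounds the distances to u in units of t. *)
Let sdiff_approx f u v w : (\forall x \near u, differentiable f x) ->
  differentiable ('D_v f) u -> forall e, 0 < e ->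
  \forall t \near 0^'+, `|sdiff f u v w t - t ^+ 2 * 'D_w ('D_v f) u| <= e * t ^+ 2.
Proof.
move=> df ddf e e0; set h := 'D_v f in ddf *.
pose K := 2 * `|v| + `|w| + 1.
have K0 : 0 < K by rewrite /K ltr_wpDl// addr_ge0// mulr_ge0.
have /nbhs_ballP[r /= r0 hr] := diff_approx ddf (divr_gt0 e0 K0).
have /nbhs_ballP[r' /= r'0 hr'] := df.
near=> t.
have t0 : 0 < t by near: t; exact: nbhs_right_gt.
have tI : 0 <= t <= t by rewrite lexx ltW.
have zI : (0 : R) <= 0 <= t by rewrite lexx ltW.
have small (s s' : R) : 0 <= s <= t -> 0 <= s' <= t ->
    ball (0 : V) r (s *: v + s' *: w) /\ differentiable f (u + s *: v + s' *: w).
  move=> /andP[s0 st] /andP[s'0 s't].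
  have H : `|s *: v + s' *: w| < Num.min r r'.
    apply: (@le_lt_trans _ _ (t * K)).
      rewrite (le_trans (ler_normD _ _))// !normrZ !ger0_norm//.
      have : s * `|v| <= t * `|v| by rewrite ler_wpM2r.
      have : s' * `|w| <= t * `|w| by rewrite ler_wpM2r.
      have : 0 <= t * `|v| by rewrite mulr_ge0// ltW.
      rewrite /K; lra.
    rewrite -ltr_pdivlMr//; near: t; apply: nbhs_right_lt.
    by rewrite divr_gt0// lt_min r0.
  move: H; rewrite lt_min => /andP[H1 H2].
  split; first by rewrite -ball_normE /= sub0r normrN.
  apply: hr'; rewrite -ball_normE /= -addrA opprD addrA subrr sub0r normrN.
  exact: H2.
pose g (s : R) := f ((u + t *: w) + s *: v) - f (u + s *: v).
pose dg (s : R) := h ((u + t *: w) + s *: v) - h (u + s *: v).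
have gdg s : 0 <= s <= t -> is_derive s (1 : R) g (dg s).
  move=> st; apply: is_deriveB.
    apply: is_derive_line; rewrite addrAC; exact: (small s t st tI).2.
  by apply: is_derive_line; have [_] := small s 0 st zI; rewrite scale0r addr0.
have [||s sI gE] := @MVT R g dg 0 t t0.
- by move=> s /[!in_itv]/= /andP[s0 s1]; apply: gdg; rewrite !ltW.
- apply: continuous_in_subspaceT => s; rewrite inE/= in_itv/= => st.
  apply: differentiable_continuous; apply/derivable1_diffP.
  by have [] := gdg s st.
have {sI}/andP[s0 st] : 0 < s < t by move: sI; rewrite in_itv.
have -> : sdiff f u v w t = t * dg s.
  move: gE; rewrite subr0 [RHS]mulrC => <-.
  rewrite /g !scale0r !addr0 /sdiff (addrAC u) !opprB; ring.
have -> : dg s = ('d h u (t *: w))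
    + (h (u + (s *: v + t *: w)) - h u - 'd h u (s *: v + t *: w))
    - (h (u + s *: v) - h u - 'd h u (s *: v)).
  by rewrite linearD /= /dg addrAC -!addrA; rewrite addrA; ring.
have sI : 0 <= s <= t by rewrite !ltW.
have [b1 _] := small s t sI tI.
have [b2 _] := small s 0 sI zI; rewrite scale0r addr0 in b2.
have /= H1 := hr _ b1; have /= H2 := hr _ b2.
have {}H1 := le_trans H1 (ler_wpM2l (ltW (divr_gt0 e0 K0)) (ler_normD _ _)).
rewrite !normrZ (gtr0_norm s0) ?(gtr0_norm t0) in H1 H2.
rewrite deriveE// linearZ /=.
set A1 := _ - 'd h u (_ + _) in H1 *; set A2 := _ - 'd h u (s *: v) in H2 *.
rewrite [t *: _](_ : _ = t * 'd h u w)//.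
rewrite -addrA mulrDr [t * (t * _)]mulrA -expr2 [t ^+ 2 * _ + _]addrC addrK.
rewrite normrM gtr0_norm// expr2 mulrA [e * t]mulrC -mulrA ler_pM2l//.
apply: le_trans (ler_normB _ _) _; apply: le_trans (lerD H1 H2) _.
rewrite -mulrDr -mulrA ler_pM2l// ler_pdivrMl// mulrC.
have : s * `|v| <= t * `|v| by rewrite ler_wpM2r// ltW.
rewrite /K; lra.
Unshelve. all: by end_near. Qed.

(** The second difference of f along v and w is symmetric in v and w, and
    divided by t^2 it tends to either of the two mixed derivatives. *)
Lemma derive_comm f u v w : (\forall x \near u, differentiable f x) ->
  differentiable ('D_v f) u -> differentiable ('D_w f) u ->
  'D_w ('D_v f) u = 'D_v ('D_w f) u.
Proof.
move=> df dv dw; apply/eqP; rewrite -subr_eq0 -normr_eq0; apply/eqP.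
apply/eqP; rewrite eq_le normr_ge0 andbT; apply/ler_addgt0Pl => e e0.
rewrite addr0; have e20 : 0 < e / 2 by rewrite divr_gt0.
have H1 := @sdiff_approx f u v w df dv _ e20.
have H2 := @sdiff_approx f u w v df dw _ e20.
have F0 : ProperFilter (0 : R)^'+ by exact: at_right_proper_filter.
have [t [[+ +] t0]] := filter_ex (filterI (filterI H1 H2) (nbhs_right_gt (0 : R))).
have -> : sdiff f u w v t = sdiff f u v w t.
  by rewrite /sdiff [u + _ + _]addrAC; ring.
have T0 : 0 < t ^+ 2 by rewrite exprn_gt0.
move: (t ^+ 2) T0 ('D_w _ u) ('D_v _ u) (sdiff _ _ _ _ _) => T T0 D1 D2 D.
rewrite !ler_norml => /andP[h1 h2] /andP[h3 h4].
rewrite -[X in X && _](ler_pM2r T0) -[X in _ && X](ler_pM2r T0).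
by apply/andP; split; lra.
Qed.

End Schwarz.

Lemma near_eq_differentiable (R : realType) (V W : normedModType R)
    (f g : V -> W) (x : V) : (\forall y \near x, f y = g y) ->
  differentiable f x -> differentiable g x.
Proof.
move=> fg df; have fgx := nbhs_singleton fg.
have /diff_locallyxP[dc _] := df; have /diffE dE := df.
have H : g = (fun y => g x + 'd f x (y - x)) +o_ x (fun y => y - x).
  apply/eqaddoP => e e0; near=> y.
  have -> : (g - (fun y0 => g x + 'd f x (y0 - x))) y = f y - (g x + 'd f x (y - x)).
    by congr (_ - _); apply/esym; near: y.
  rewrite dE lim_id// fgx addrAC subrr add0r.
  by near: y; apply: littleoP.
apply/diffP.
(* The differential is a choice among the continuous linear maps that satisfy
   the first-order expansion, so one such map for g suffices. *)
apply: (@getPex _ (fun (df : {linear V -> W}) => continuous df /\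
  forall y, g y = g (lim (nbhs x)) + df (y - lim (nbhs x))
                  +o_(y \near x) (y - lim (nbhs x)))).
exists ('d f x); split=> // y; rewrite lim_id//; exact: (congr1 (@^~ y) H).
Unshelve. all: by end_near. Qed.

(** * Smooth functions *)
Section SmoothOn.
Context {R : realType} {n : nat} (U : set 'cV[R]_n) (oU : open U).
Implicit Types (f g h : 'cV[R]_n -> R).

(** [smooth_on] differentiates last on the outside; here the first derivatives
    are taken first, which is the form in which the Leibniz rule supports an
    induction on the order. *)
Fixpoint cont_diff k h : Prop :=
  (forall x, U x -> differentiable h x) /\
  if k is k'.+1 then forall i, cont_diff k' (partial i h) else True.

Lemma smooth_onP h : smooth_on U h <-> forall k, cont_diff k h.
Proof.
split=> [H k|H s].
  have : forall s, forall x, U x -> differentiable (foldr (@partial R n) h s) x by [].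
  elim: k h {H} => [|k IH] h H; first by split=> // x; exact: (H [::]).
  split=> [x|i]; first exact: (H [::]).
  by apply: IH => s x Ux; have := H (rcons s i) x Ux; rewrite foldr_rcons.
elim/last_ind: s h H => [|s i IH] h H x Ux; first by have [D _] := H 0%N; exact: D.
by rewrite foldr_rcons; apply: IH => // k; have [_ D] := H k.+1; exact: D.
Qed.

Lemma partial_eq f g i : (forall x, U x -> f x = g x) ->
  forall x, U x -> partial i f x = partial i g x.
Proof.
move=> fg x Ux; apply: near_eq_derive.
by near=> y; apply: fg; near: y; exact: open_nbhs_nbhs.
Unshelve. all: by end_near. Qed.

Lemma cont_diff_eq k f g : (forall x, U x -> f x = g x) ->
  cont_diff k f -> cont_diff k g.
Proof.
have H f' g' : (forall x, U x -> f' x = g' x) ->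
    (forall x, U x -> differentiable f' x) -> (forall x, U x -> differentiable g' x).
  move=> fg df x Ux; apply: (near_eq_differentiable _ (df x Ux)).
  by near=> y; apply: fg; near: y; exact: open_nbhs_nbhs.
elim: k f g => [|k IH] f g fg /= [df D]; split; try exact: H df.
  by [].
by move=> i; apply: (IH (partial i f)) => //; exact: partial_eq.
Unshelve. all: by end_near. Qed.

Lemma cont_diffS k f : cont_diff k.+1 f -> cont_diff k f.
Proof.
by elim: k f => [|k IH] f /= [df D]; split=> // i; apply: IH.
Qed.

Lemma cont_diff_cst k (a : R) : cont_diff k (fun=> a).
Proof.
elim: k a => [|k IH] a; split=> // i.
apply: (cont_diff_eq _ (IH 0)) => x Ux.
by rewrite /partial derive_cst.
Qed.

Lemma cont_diffD k f g : cont_diff k f -> cont_diff k g ->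
  cont_diff k (fun x => f x + g x).
Proof.
elim: k f g => [|k IH] f g [df Df] [dg Dg];
  (split; first by move=> x Ux; apply: differentiableD; [exact: df|exact: dg]).
  by [].
move=> i.
apply: cont_diff_eq (IH _ _ (Df i) (Dg i)) => x Ux.
by rewrite /partial deriveD//; apply: diff_derivable; [exact: df|exact: dg].
Qed.

Lemma cont_diffM k f g : cont_diff k f -> cont_diff k g ->
  cont_diff k (fun x => f x * g x).
Proof.
elim: k f g => [|k IH] f g cf cg; have [df Df] := cf; have [dg Dg] := cg;
  (split; first by move=> x Ux; apply: differentiableM; [exact: df|exact: dg]).
  by [].
move=> i.
have := cont_diffD (IH _ _ (cont_diffS cf) (Dg i)) (IH _ _ (cont_diffS cg) (Df i)).
apply: cont_diff_eq => x Ux.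
by rewrite /partial deriveM//; apply: diff_derivable; [exact: df|exact: dg].
Qed.

Lemma cont_diffV k f : (forall x, U x -> f x != 0) -> cont_diff k f ->
  cont_diff k (fun x => (f x)^-1).
Proof.
move=> f0; elim: k => [|k IH] cf; have [df Df] := cf;
  (split; first by move=> x Ux; apply: differentiableV; [exact: df|exact: f0]).
  by [].
move=> i.
have Vf := IH (cont_diffS cf).
have := cont_diffM (cont_diff_cst k (-1)) (cont_diffM (cont_diffM Vf Vf) (Df i)).
apply: cont_diff_eq => x Ux.
rewrite /partial deriveV//; [|exact: f0|by apply: diff_derivable; exact: df].
by rewrite -exprVn expr2 mulN1r scaleNr.
Qed.

Lemma smooth_on_eq f g : (forall x, U x -> f x = g x) ->
  smooth_on U f -> smooth_on U g.
Proof. by move=> fg /smooth_onP H; apply/smooth_onP => k; apply: cont_diff_eq (H k). Qed.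

Lemma smooth_on_cst (a : R) : smooth_on U (fun=> a).
Proof. by apply/smooth_onP => k; exact: cont_diff_cst. Qed.

Lemma smooth_onD f g : smooth_on U f -> smooth_on U g ->
  smooth_on U (fun x => f x + g x).
Proof.
by move=> /smooth_onP Hf /smooth_onP Hg; apply/smooth_onP => k; exact: cont_diffD.
Qed.

Lemma smooth_onM f g : smooth_on U f -> smooth_on U g ->
  smooth_on U (fun x => f x * g x).
Proof.
by move=> /smooth_onP Hf /smooth_onP Hg; apply/smooth_onP => k; exact: cont_diffM.
Qed.

Lemma smooth_onV f : (forall x, U x -> f x != 0) -> smooth_on U f ->
  smooth_on U (fun x => (f x)^-1).
Proof.
by move=> f0 /smooth_onP Hf; apply/smooth_onP => k; exact: cont_diffV.
Qed.

Lemma smooth_on_sum (I : Type) (r : seq I) (P : pred I) (f : I -> 'cV[R]_n -> R) :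
  (forall i, P i -> smooth_on U (f i)) -> smooth_on U (fun x => \sum_(i <- r | P i) f i x).
Proof.
move=> H; elim: r => [|i r IH].
  by apply: smooth_on_eq (smooth_on_cst 0) => x Ux; rewrite big_nil.
have [Pi|nPi] := boolP (P i); last first.
  by apply: smooth_on_eq IH => x Ux; rewrite big_cons (negbTE nPi).
by apply: smooth_on_eq (smooth_onD (H i Pi) IH) => x Ux; rewrite big_cons Pi.
Qed.

Lemma smooth_on_prod (I : Type) (r : seq I) (P : pred I) (f : I -> 'cV[R]_n -> R) :
  (forall i, P i -> smooth_on U (f i)) -> smooth_on U (fun x => \prod_(i <- r | P i) f i x).
Proof.
move=> H; elim: r => [|i r IH].
  by apply: smooth_on_eq (smooth_on_cst 1) => x Ux; rewrite big_nil.
have [Pi|nPi] := boolP (P i); last first.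
  by apply: smooth_on_eq IH => x Ux; rewrite big_cons (negbTE nPi).
by apply: smooth_on_eq (smooth_onM (H i Pi) IH) => x Ux; rewrite big_cons Pi.
Qed.

Lemma smooth_on_diff f x : smooth_on U f -> U x -> differentiable f x.
Proof. by move=> H; exact: (H [::]). Qed.

Lemma smooth_on_partial f i : smooth_on U f -> smooth_on U (partial i f).
Proof.
by move=> H s x Ux; have := H (rcons s i) x Ux; rewrite foldr_rcons.
Qed.

Lemma derive_partial f x X : differentiable f x ->
  'D_X f x = \sum_i X i 0 * partial i f x.
Proof.
move=> df; rewrite deriveE// {1}(matrix_sum_delta X).
rewrite linear_sum; apply: eq_bigr => i _.
by rewrite big_ord1 linearZ /partial deriveE.
Qed.

Lemma smooth_on_derive f X : smooth_on U f -> smooth_on U ('D_X f).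
Proof.
move=> sf; apply: (@smooth_on_eq (fun x => \sum_i X i 0 * partial i f x)).
  by move=> x Ux; rewrite derive_partial//; exact: smooth_on_diff.
apply: smooth_on_sum => i _; apply: smooth_onM; first exact: smooth_on_cst.
exact: smooth_on_partial.
Qed.

Lemma smooth_on_comm f x X Y : smooth_on U f -> U x ->
  'D_X ('D_Y f) x = 'D_Y ('D_X f) x.
Proof.
move=> sf Ux; apply: derive_comm.
- by near=> y; apply: smooth_on_diff => //; near: y; exact: open_nbhs_nbhs.
- by apply: smooth_on_diff Ux; exact: smooth_on_derive.
- by apply: smooth_on_diff Ux; exact: smooth_on_derive.
Unshelve. all: by end_near. Qed.

End SmoothOn.

(** * Differential calculus in a chart *)
(** Sealed forms of [dir] and [jac]: both are matrices given by their entries, as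
    is a product of matrices, so that without the seal unification compares
    their entries. *)
HB.lock Definition pdir (R : realType) (n : nat) (M : manifold R n) (a b : nat)
  (k : chart M) (X : 'cV[R]_n) (H : M -> 'M[R]_(a, b)) (x : M) := dir k X H x.

HB.lock Definition jacm (R : realType) (n : nat) (M : manifold R n) (a : nat)
  (k : chart M) (H : M -> 'cV[R]_a) (x : M) := jac k H x.

Section ChartCalculus.
Context {R : realType} {n : nat} {M : manifold R n} (k : chart M) (S : set M).
Hypothesis oS : open S.
Local Notation W := (cdom k `&` S).
Implicit Types (x y : M) (X Y : 'cV[R]_n).

Lemma pdirE a b X (H : M -> 'M[R]_(a, b)) x s t :
  pdir k X H x s t = 'D_X (fun u => H (cinv k u) s t) (cmap k x).
Proof. by rewrite pdir.unlock mxE. Qed.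

Lemma jacmE a (H : M -> 'cV[R]_a) x s i :
  jacm k H x s i = pdir k (delta_mx i 0) H x s 0.
Proof. by rewrite jacm.unlock pdir.unlock mxE. Qed.

Lemma dir_pdir a b X (H : M -> 'M[R]_(a, b)) : dir k X H = pdir k X H.
Proof. by apply/funext => x; rewrite pdir.unlock. Qed.

Lemma jac_jacm a (H : M -> 'cV[R]_a) : jac k H = jacm k H.
Proof. by apply/funext => x; rewrite jacm.unlock. Qed.

Definition csmooth a b (H : M -> 'M[R]_(a, b)) :=
  forall s t, smooth_on (cmap k @` W) (fun u => H (cinv k u) s t).

Lemma open_img : open (cmap k @` W).
Proof.
rewrite openE => _ [x [kx Sx] <-].
have Kx : (cmap k @` cdom k) (cmap k x) by exists x.
have N1 : nbhs (cmap k x) (cmap k @` cdom k).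
  by apply: open_nbhs_nbhs; split => //; exact: cimg_open.
have N2 : nbhs (cmap k x) (cinv k @^-1` S).
  apply: (cinv_continuous Kx); rewrite cmapK//.
  by apply: open_nbhs_nbhs.
apply: filterS (filterI N1 N2) => _ [[y ky <-]]; rewrite /= cmapK// => Sy.
by exists y.
Qed.
Let oU := open_img.

Lemma in_img x : W x -> (cmap k @` W) (cmap k x).
Proof. by move=> Wx; exists x. Qed.

Lemma csmooth_diff a b (H : M -> 'M[R]_(a, b)) s t x : csmooth H -> W x ->
  differentiable (fun u => H (cinv k u) s t) (cmap k x).
Proof. by move=> sH Wx; apply: smooth_on_diff (sH s t) (in_img Wx). Qed.

Lemma csmooth_derivable a b (H : M -> 'M[R]_(a, b)) s t x X : csmooth H -> W x ->
  derivable (fun u => H (cinv k u) s t) (cmap k x) X.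
Proof. by move=> sH Wx; apply: diff_derivable; exact: csmooth_diff. Qed.

Lemma csmooth_eq a b (A B : M -> 'M[R]_(a, b)) : (forall x, W x -> A x = B x) ->
  csmooth A -> csmooth B.
Proof.
move=> AB sA s t; apply: (smooth_on_eq oU) (sA s t) => _ [x Wx <-].
by rewrite cmapK ?AB//; case: Wx.
Qed.

Lemma dir_eq a b (A B : M -> 'M[R]_(a, b)) x X : (forall y, W y -> A y = B y) ->
  W x -> pdir k X A x = pdir k X B x.
Proof.
move=> AB Wx; apply/matrixP => s t; rewrite !pdirE; apply: near_eq_derive.
apply: filterS (open_nbhs_nbhs (conj oU (in_img Wx))) => _ [y Wy <-].
by rewrite cmapK ?AB//; case: Wy.
Qed.

Lemma csmooth_cst a b (A : 'M[R]_(a, b)) : csmooth (fun=> A).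
Proof. by move=> s t; exact: smooth_on_cst. Qed.

Lemma csmoothD a b (A B : M -> 'M[R]_(a, b)) : csmooth A -> csmooth B ->
  csmooth (fun x => A x + B x).
Proof.
move=> sA sB s t; apply: (smooth_on_eq oU) (smooth_onD oU (sA s t) (sB s t)) => u _.
by rewrite mxE.
Qed.

Lemma csmoothZ a b c (A : M -> 'M[R]_(a, b)) : csmooth A ->
  csmooth (fun x => c *: A x).
Proof.
move=> sA s t; apply: (smooth_on_eq oU)
  (smooth_onM oU (smooth_on_cst oU c) (sA s t)) => u _.
by rewrite mxE.
Qed.

Lemma csmoothN a b (A : M -> 'M[R]_(a, b)) : csmooth A ->
  csmooth (fun x => - A x).
Proof.
move=> /(csmoothZ (-1)); apply: csmooth_eq => x _; exact: scaleN1r.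
Qed.

Lemma csmoothB a b (A B : M -> 'M[R]_(a, b)) : csmooth A -> csmooth B ->
  csmooth (fun x => A x - B x).
Proof. by move=> sA /csmoothN; exact: csmoothD. Qed.

Lemma csmooth_tr a b (A : M -> 'M[R]_(a, b)) : csmooth A ->
  csmooth (fun x => (A x)^T).
Proof.
by move=> sA s t; apply: (smooth_on_eq oU) (sA t s) => u _; rewrite mxE.
Qed.

Lemma csmoothM a b c (A : M -> 'M[R]_(a, b)) (B : M -> 'M[R]_(b, c)) :
  csmooth A -> csmooth B -> csmooth (fun x => A x *m B x).
Proof.
move=> sA sB s t.
apply: (@smooth_on_eq _ _ _ oU
  (fun u => \sum_j A (cinv k u) s j * B (cinv k u) j t)).
  by move=> u _; rewrite mxE.
by apply: smooth_on_sum => // j _; apply: smooth_onM; [|exact: sA|exact: sB].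
Qed.

Lemma smooth_on_det a (A : M -> 'M[R]_a) : csmooth A ->
  smooth_on (cmap k @` W) (fun u => \det (A (cinv k u))).
Proof.
move=> sA; apply: (smooth_on_sum oU) => s _; apply: (smooth_onM oU).
  exact: smooth_on_cst.
by apply: (smooth_on_prod oU) => i _; exact: sA.
Qed.

Lemma csmooth_inv a (A : M -> 'M[R]_a) : (forall x, W x -> A x \in unitmx) ->
  csmooth A -> csmooth (fun x => invmx (A x)).
Proof.
move=> uA sA s t.
apply: (@smooth_on_eq _ _ _ oU (fun u => (\det (A (cinv k u)))^-1 *
  ((-1) ^+ (t + s) * \det (row' t (col' s (A (cinv k u))))))).
  move=> _ [x Wx <-]; have [kx _] := Wx; have := uA _ Wx.
  by rewrite cmapK// /invmx => ->; rewrite !mxE.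
apply: (smooth_onM oU).
  apply: (smooth_onV oU); last exact: smooth_on_det.
  move=> _ [x Wx <-]; have [kx _] := Wx; have := uA _ Wx.
  by rewrite cmapK// unitmxE unitfE.
apply: (smooth_onM oU); first exact: smooth_on_cst.
apply: (smooth_on_det (A := fun x => row' t (col' s (A x)))) => i j.
by apply: (smooth_on_eq oU) (sA (lift t i) (lift s j)) => u _; rewrite !mxE.
Qed.

Lemma csmooth_dir a b (A : M -> 'M[R]_(a, b)) X : csmooth A ->
  csmooth (pdir k X A).
Proof.
move=> sA s t.
apply: (smooth_on_eq oU) (smooth_on_derive oU X (sA s t)) => _ [x [kx _] <-].
by rewrite pdirE cmapK.
Qed.

Lemma csmooth_jac a (A : M -> 'cV[R]_a) : csmooth A -> csmooth (jacm k A).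
Proof.
move=> sA s i; apply: (smooth_on_eq oU) (csmooth_dir (delta_mx i 0) sA s 0) => u _.
by rewrite jacmE.
Qed.

Lemma dirD a b (A B : M -> 'M[R]_(a, b)) x X : csmooth A -> csmooth B -> W x ->
  pdir k X (fun y => A y + B y) x = pdir k X A x + pdir k X B x.
Proof.
move=> sA sB Wx; apply/matrixP => s t; rewrite !(pdirE, mxE).
pose f u := A (cinv k u) s t; pose g u := B (cinv k u) s t.
rewrite (_ : (fun u => (A (cinv k u) + B (cinv k u)) s t) = f + g); last first.
  by apply/funext => u; rewrite mxE.
by rewrite deriveD//; exact: csmooth_derivable.
Qed.

Lemma dirZ a b c (A : M -> 'M[R]_(a, b)) x X : csmooth A -> W x ->
  pdir k X (fun y => c *: A y) x = c *: pdir k X A x.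
Proof.
move=> sA Wx; apply/matrixP => s t; rewrite !(pdirE, mxE).
pose f u := A (cinv k u) s t.
rewrite (_ : (fun u => (c *: A (cinv k u)) s t) = c *: f); last first.
  by apply/funext => u; rewrite mxE.
by rewrite deriveZ//; exact: csmooth_derivable.
Qed.

Lemma dirN a b (A : M -> 'M[R]_(a, b)) x X : csmooth A -> W x ->
  pdir k X (fun y => - A y) x = - pdir k X A x.
Proof.
move=> sA Wx; rewrite -scaleN1r -dirZ//.
by apply: dir_eq => // y _; rewrite scaleN1r.
Qed.

Lemma dirB a b (A B : M -> 'M[R]_(a, b)) x X : csmooth A -> csmooth B -> W x ->
  pdir k X (fun y => A y - B y) x = pdir k X A x - pdir k X B x.
Proof. by move=> sA sB Wx; rewrite dirD ?dirN//; exact: csmoothN. Qed.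

Lemma dir_cst a b (A : 'M[R]_(a, b)) x X : pdir k X (fun=> A) x = 0.
Proof. by apply/matrixP => s t; rewrite pdirE mxE derive_cst. Qed.

Lemma dir_tr a b (A : M -> 'M[R]_(a, b)) x X :
  pdir k X (fun y => (A y)^T) x = (pdir k X A x)^T.
Proof.
apply/matrixP => s t; rewrite !(pdirE, mxE).
rewrite (_ : (fun u => (A (cinv k u))^T s t) = (fun u => A (cinv k u) t s))//.
by apply/funext => u; rewrite mxE.
Qed.

Lemma dirM a b c (A : M -> 'M[R]_(a, b)) (B : M -> 'M[R]_(b, c)) x X :
  csmooth A -> csmooth B -> W x ->
  pdir k X (fun y => A y *m B y) x = pdir k X A x *m B x + A x *m pdir k X B x.
Proof.
move=> sA sB Wx; have [kx _] := Wx; apply/matrixP => s t; rewrite !(pdirE, mxE).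
pose f j u := A (cinv k u) s j; pose g j u := B (cinv k u) j t.
pose h j := f j * g j.
rewrite (_ : (fun u => (A (cinv k u) *m B (cinv k u)) s t) = \sum_j h j); last first.
  by apply/funext => u; rewrite mxE fct_sumE.
rewrite derive_sum => [|j]; last by apply: derivableM; exact: csmooth_derivable.
rewrite -big_split; apply: eq_bigr => j _ /=; rewrite !pdirE.
have fgE : 'D_X (f j * g j) (cmap k x) =
    'D_X (f j) (cmap k x) * g j (cmap k x) + f j (cmap k x) * 'D_X (g j) (cmap k x).
  rewrite deriveM; [|exact: csmooth_derivable..].
  move: ('D_X (f j) _) ('D_X (g j) _) (f j _) (g j _) => df dg fx gx.
  by rewrite addrC; congr (_ + _); exact: mulrC.
by rewrite fgE /f /g cmapK.
Qed.

Lemma dirMr a b c (A : M -> 'M[R]_(a, b)) (B : 'M[R]_(b, c)) x X :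
  csmooth A -> W x -> pdir k X (fun y => A y *m B) x = pdir k X A x *m B.
Proof.
by move=> sA Wx; rewrite dirM// ?dir_cst ?mulmx0 ?addr0//; exact: csmooth_cst.
Qed.

Lemma dirMl a b c (A : 'M[R]_(a, b)) (B : M -> 'M[R]_(b, c)) x X :
  csmooth B -> W x -> pdir k X (fun y => A *m B y) x = A *m pdir k X B x.
Proof.
by move=> sA Wx; rewrite dirM// ?dir_cst ?mul0mx ?add0r//; exact: csmooth_cst.
Qed.

Lemma dir_comm a b (A : M -> 'M[R]_(a, b)) x X Y : csmooth A -> W x ->
  pdir k X (pdir k Y A) x = pdir k Y (pdir k X A) x.
Proof.
move=> sA Wx; apply/matrixP => s t; rewrite [LHS]pdirE [RHS]pdirE.
have H Z Z' : 'D_Z (fun u => pdir k Z' A (cinv k u) s t) (cmap k x) =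
    'D_Z ('D_Z' (fun u => A (cinv k u) s t)) (cmap k x).
  apply: near_eq_derive.
  apply: filterS (open_nbhs_nbhs (conj oU (in_img Wx))) => _ [y [ky _] <-].
  by rewrite pdirE cmapK.
by rewrite !H; apply: (smooth_on_comm oU) => //; exact: in_img.
Qed.

Lemma dir_sum a b (A : M -> 'M[R]_(a, b)) x X : csmooth A -> W x ->
  pdir k X A x = \sum_i X i 0 *: pdir k (delta_mx i 0) A x.
Proof.
move=> sA Wx; apply/matrixP => s t; rewrite summxE pdirE derive_partial.
  by apply: eq_bigr => i _; rewrite !(pdirE, mxE).
exact: csmooth_diff.
Qed.

Lemma dirDX a b (A : M -> 'M[R]_(a, b)) x X Y : csmooth A -> W x ->
  pdir k (X + Y) A x = pdir k X A x + pdir k Y A x.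
Proof.
move=> sA Wx; rewrite !dir_sum// -big_split; apply: eq_bigr => i _ /=.
by rewrite mxE scalerDl.
Qed.

Lemma jac_mul a (A : M -> 'cV[R]_a) x X : csmooth A -> W x ->
  jacm k A x *m X = pdir k X A x.
Proof.
move=> sA Wx; rewrite dir_sum//; apply/colP => s; rewrite summxE mxE.
by apply: eq_bigr => i _; rewrite jacmE mxE mulrC.
Qed.

Lemma jac_mul_fun a (A : M -> 'cV[R]_a) x X Y : csmooth A -> W x ->
  pdir k X (jacm k A) x *m Y = pdir k X (pdir k Y A) x.
Proof.
move=> sA Wx; rewrite -dirMr//; last exact: csmooth_jac.
by apply: dir_eq => // y Wy; rewrite jac_mul.
Qed.

Lemma dir_jac_sym a (A : M -> 'cV[R]_a) x X Y : csmooth A -> W x ->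
  pdir k X (jacm k A) x *m Y = pdir k Y (jacm k A) x *m X.
Proof.
move=> sA Wx; apply: etrans (jac_mul_fun X Y sA Wx) _.
apply: etrans (dir_comm X Y sA Wx) _; exact/esym/jac_mul_fun.
Qed.

End ChartCalculus.

Section InverseDerivative.
Context {R : realType} {n : nat} {M : manifold R n} (k : chart M) (S : set M).
Hypothesis oS : open S.

Lemma dir_invmx a (A : M -> 'M[R]_a) x X : csmooth k S A ->
  (forall y, (cdom k `&` S) y -> A y \in unitmx) -> (cdom k `&` S) x ->
  pdir k X (fun y => invmx (A y)) x = - (invmx (A x) *m pdir k X A x *m invmx (A x)).
Proof.
move=> sA uA Wx; have sV := csmooth_inv oS uA sA.
have cst y : (cdom k `&` S) y -> A y *m invmx (A y) = 1%:M.
  by move=> Wy; rewrite mulmxV// uA.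
have := dir_eq oS X cst Wx; rewrite dir_cst (dirM _ sA sV Wx) => /eqP.
rewrite addrC addr_eq0 => /eqP H.
by rewrite -[LHS](mulKmx (uA x Wx)) H mulmxN mulmxA.
Qed.

Lemma jac_eq a (A B : M -> 'cV[R]_a) x :
  (forall y, (cdom k `&` S) y -> A y = B y) -> (cdom k `&` S) x ->
  jacm k A x = jacm k B x.
Proof.
by move=> AB Wx; apply/matrixP => s i; rewrite !jacmE (dir_eq oS _ AB Wx).
Qed.

End InverseDerivative.

Section ChartChange.
Context {R : realType} {n : nat} {M : manifold R n} (k l : chart M) (S : set M).
Hypothesis oS : open S.

Lemma cmap_csmooth : csmooth k (cdom l) (cmap l).
Proof. by move=> s t; rewrite ord1; exact: transition_smooth. Qed.

(** The chain rule for the transition map of the two charts. *)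
Lemma dir_change a b (A : M -> 'M[R]_(a, b)) x X : csmooth l S A ->
  (cdom k `&` cdom l `&` S) x ->
  pdir k X A x = pdir l (pdir k X (cmap l) x) A x.
Proof.
move=> sA [[kx lx] Sx]; apply/matrixP => s t; rewrite !pdirE.
pose f u := A (cinv l u) s t; pose h u := cmap l (cinv k u).
have df : differentiable f (h (cmap k x)).
  by rewrite /h cmapK//; exact: (csmooth_diff s t sA (conj lx Sx)).
have dh : differentiable h (cmap k x).
  pose hi i u := h u i 0 *: (delta_mx i 0 : 'cV[R]_n).
  rewrite (_ : h = \sum_i hi i); last first.
    apply/funext => u; rewrite fct_sumE [LHS]matrix_sum_delta.
    by apply: eq_bigr => i _; rewrite big_ord1.
  apply: differentiable_sum => i; apply: differentiableZl.
  exact: (csmooth_diff i 0 cmap_csmooth (conj kx lx)).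
have -> : 'D_X (fun u => A (cinv k u) s t) (cmap k x) = 'D_X (f \o h) (cmap k x).
  apply: near_eq_derive.
  have oW : open (cdom l `&` S) by apply: openI => //; exact: cdom_open.
  have Wx : (cmap k @` (cdom k `&` (cdom l `&` S))) (cmap k x) by exists x.
  apply: filterS (open_nbhs_nbhs (conj (open_img (k := k) oW) Wx)).
  by move=> _ [y [ky [ly Sy]] <-]; rewrite /f /h /= !cmapK.
rewrite deriveE; last exact: differentiable_comp.
rewrite diff_comp//= -deriveE// -deriveE//.
rewrite /h cmapK//; congr ('D__ _ _).
by rewrite derive_mx; [apply/matrixP => i j; rewrite pdirE !mxE ord1|exact: diff_derivable].
Qed.

Lemma jac_change a (A : M -> 'cV[R]_a) x : csmooth l S A ->
  (cdom k `&` cdom l `&` S) x ->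
  jacm k A x = jacm l A x *m jacm k (cmap l) x.
Proof.
move=> sA Wx; have [[kx lx] Sx] := Wx.
apply/matrixP => s i.
rewrite jacmE (dir_change _ sA Wx) -(jac_mul _ sA (conj lx Sx)) !mxE.
by apply: eq_bigr => j _; congr (_ * _); rewrite jacmE.
Qed.

End ChartChange.

(** * Matrices and adjoints *)
Lemma mulmx_cV_inj (R : realType) a b (A B : 'M[R]_(a, b)) :
  (forall X : 'cV[R]_b, A *m X = B *m X) -> A = B.
Proof.
move=> AB; apply/trmx_inj/row_matrixP => i; rewrite !rowE.
by apply: trmx_inj; rewrite !trmx_mul !trmxK trmx_delta AB.
Qed.

Lemma mx11_eq (R : realType) (A B : 'M[R]_1) : A 0 0 = B 0 0 -> A = B.
Proof. by move=> AB; rewrite (mx11_scalar A) (mx11_scalar B) AB. Qed.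

Lemma tr_mx11 (R : realType) (A : 'M[R]_1) : A^T = A.
Proof. by apply: mx11_eq; rewrite mxE. Qed.

(** Sealed form of [adj], so that its products are atoms for rewriting. *)
HB.lock Definition adjm (R : realType) (ct : R) (N q : nat) (H : 'M[R]_(N, q)) :
  'M[R]_(q, N) := adj ct H.

Lemma adjmE (R : realType) (ct : R) (N q : nat) (H : 'M[R]_(N, q)) :
  adj ct H = adjm ct H.
Proof. by rewrite adjm.unlock. Qed.

Section Entries.
Context {R : realType} {a b : nat}.
Implicit Types A B : 'M[R]_(a, b).

Lemma mx_addE A B i j : (A + B) i j = A i j + B i j. Proof. by rewrite mxE. Qed.
Lemma mx_oppE A i j : (- A) i j = - A i j. Proof. by rewrite mxE. Qed.
Lemma mx_scaleE e A i j : (e *: A) i j = e * A i j. Proof. by rewrite mxE. Qed.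
Lemma mx_zeroE i j : (0 : 'M[R]_(a, b)) i j = 0. Proof. by rewrite mxE. Qed.

Lemma mx_trD A B : (A + B)^T = A^T + B^T. Proof. exact: linearD. Qed.
Lemma mx_trN A : (- A)^T = - A^T. Proof. exact: linearN. Qed.
Lemma mx_trZ e A : (e *: A)^T = e *: A^T. Proof. exact: linearZ. Qed.

End Entries.

Definition mx_trE := (@mx_trD, @mx_trN, @mx_trZ).

(** Equality of linear combinations of matrix products, the products being
    left-associated and taken as atoms. *)
Ltac mxlin := apply/matrixP => ? ?;
  rewrite ?(mx_addE, mx_oppE, mx_scaleE, mx_zeroE); ring.

Ltac mxnf := rewrite ?(mulmxBl, mulmxBr, mulmxDl, mulmxDr, mulmxN, mulNmx,
  mul1mx, mulmx1, mul0mx, mulmx0, mulmxA).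

Section Adj.
Context {R : realType} (ct : R) {N : nat}.

Lemma ambient_gram_tr : (ambient_gram ct N)^T = ambient_gram ct N.
Proof. by rewrite /ambient_gram tr_diag_mx. Qed.

Lemma adjmM a b (A : 'M[R]_(N, a)) (B : 'M[R]_(a, b)) :
  adjm ct (A *m B) = B^T *m adjm ct A.
Proof. by rewrite -!adjmE /adj trmx_mul mulmxA. Qed.

Lemma tr_adjmM a b (A : 'M[R]_(N, a)) (B : 'M[R]_(N, b)) :
  (adjm ct A *m B)^T = adjm ct B *m A.
Proof. by rewrite -!adjmE /adj !trmx_mul trmxK ambient_gram_tr mulmxA. Qed.

Lemma adjmD a (A B : 'M[R]_(N, a)) : adjm ct (A + B) = adjm ct A + adjm ct B.
Proof. by rewrite -!adjmE /adj raddfD mulmxDl. Qed.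

Lemma adjmN a (A : 'M[R]_(N, a)) : adjm ct (- A) = - adjm ct A.
Proof. by rewrite -!adjmE /adj raddfN mulNmx. Qed.

Lemma adjmZ a c (A : 'M[R]_(N, a)) : adjm ct (c *: A) = c *: adjm ct A.
Proof. by rewrite -!adjmE /adj linearZ /= scalemxAl. Qed.

Lemma adjm_sum a (I : finType) (A : I -> 'M[R]_(N, a)) :
  adjm ct (\sum_i A i) = \sum_i adjm ct (A i).
Proof.
rewrite -adjmE /adj raddf_sum mulmx_suml; apply: eq_bigr => i _.
by rewrite -adjmE.
Qed.

Definition ip (A B : 'cV[R]_N) : R := (adjm ct A *m B) 0 0.

Lemma ipC (A B : 'cV[R]_N) : ip A B = ip B A.
Proof. by rewrite /ip -[adjm ct A *m B]tr_mx11 tr_adjmM. Qed.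

Lemma ipDl (A A' B : 'cV[R]_N) : ip (A + A') B = ip A B + ip A' B.
Proof. by rewrite /ip adjmD mulmxDl mxE. Qed.

Context {n : nat} {M : manifold R n} (k : chart M) (S : set M).
Hypothesis oS : open S.

Lemma csmooth_adj a (A : M -> 'M[R]_(N, a)) : csmooth k S A ->
  csmooth k S (fun x => adjm ct (A x)).
Proof.
move=> sA; apply: (csmooth_eq oS (A := fun x => (A x)^T *m ambient_gram ct N)).
  by move=> x _; rewrite -adjmE.
by apply: csmoothM => //; [exact: csmooth_tr|exact: csmooth_cst].
Qed.

Lemma dir_adj a (A : M -> 'M[R]_(N, a)) x X : csmooth k S A ->
  (cdom k `&` S) x ->
  pdir k X (fun y => adjm ct (A y)) x = adjm ct (pdir k X A x).
Proof.
move=> sA Wx.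
have E y : (cdom k `&` S) y -> adjm ct (A y) = (A y)^T *m ambient_gram ct N.
  by rewrite -adjmE.
by rewrite (dir_eq oS _ E Wx) (dirMr oS) ?dir_tr -?adjmE//; exact: csmooth_tr.
Qed.

End Adj.

Ltac smoothness := repeat first
  [ assumption
  | apply: csmooth_cst | apply: csmoothD | apply: csmoothB
  | apply: csmoothN | apply: csmoothZ | apply: csmoothM
  | apply: csmooth_tr | apply: csmooth_adj | apply: csmooth_jac
  | apply: csmooth_dir ].

(** * Immersions through flat derivatives *)
Section TangentProjection.
Context {R : realType} {n p : nat} {ct : R} {M : manifold R n}.
Local Notation N := (ambient_dim n p ct).

Definition tproj (k : chart M) (g : metric_field M) (F : M -> 'cV[R]_N) (x : M) :
    'M[R]_N :=
  jacm k F x *m invmx (g k x) *m adjm ct (jacm k F x).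

Definition gradm (k : chart M) (g : metric_field M) m (phi : M -> 'cV[R]_m)
    (x : M) : 'M[R]_(n, m) :=
  invmx (g k x) *m (jacm k phi x)^T.

End TangentProjection.

HB.lock Definition nproj (R : realType) (n p : nat) (ct : R) (M : manifold R n)
    (k : chart M) (g : metric_field M) (F : M -> 'cV[R]_(ambient_dim n p ct))
    (x : M) : 'M[R]_(ambient_dim n p ct) :=
  1%:M - tproj k g F x.

(** [calG] is computed at x in the chart [chart_at x], which jumps with x; the
    same expression in one fixed chart can be differentiated. *)
HB.lock Definition chartG (R : realType) (n p : nat) (ct : R) (M : manifold R n)
    (k : chart M) (g : metric_field M) (F : M -> 'cV[R]_(ambient_dim n p ct))
    (m : nat) (phi : M -> 'cV[R]_m) (beta : M -> 'M[R]_(ambient_dim n p ct, m))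
    (x : M) : 'M[R]_(ambient_dim n p ct, m) :=
  jacm k F x *m gradm k g phi x + beta x + ct *: (F x *m (phi x)^T).

Section Geometry.
Context {R : realType} {n p : nat} {ct : R} {M : manifold R n}.
Local Notation N := (ambient_dim n p ct).
Context (k : chart M) (S : set M) (g : metric_field M) (F : M -> 'cV[R]_N).
Hypothesis hI : isometric_immersion S g F.
Local Notation W := (cdom k `&` S).
Local Notation T := (jacm k F).
Implicit Types (x y : M) (X Y Z V : 'cV[R]_n).

Lemma immersion_open : open S. Proof. by case: hI. Qed.
Let oS := immersion_open.
Hint Resolve immersion_open : core.

Lemma immersion_smooth : csmooth k S F. Proof. by case: hI => _ _ sF _ _; exact: sF. Qed.
Let sF := immersion_smooth.
Hint Resolve immersion_smooth : core.

Let sT : csmooth k S T. Proof. exact: csmooth_jac. Qed.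
Hint Resolve sT : core.

Lemma metric_smooth : csmooth k S (g k).
Proof. by case: hI => _ [sg _ _ _] _ _ _; exact: sg. Qed.
Let sg := metric_smooth.
Hint Resolve sg : core.

Lemma metricE x : W x -> adjm ct (T x) *m T x = g k x.
Proof. by move=> Wx; case: hI => _ _ _ _ ind; rewrite -adjmE -jac_jacm; exact: ind. Qed.

Lemma metric_tr x : W x -> (g k x)^T = g k x.
Proof. by move=> Wx; case: hI => _ [_ sym _ _] _ _ _; exact: sym. Qed.

Lemma metric_unit x : W x -> g k x \in unitmx.
Proof.
move=> Wx; rewrite unitmxE unitfE; apply/negP => /det0P[v v0 vg].
case: hI => _ [_ _ pos _] _ _ _.
have vT0 : v^T != 0.
  by apply: contra v0 => /eqP v0; apply/eqP/trmx_inj; rewrite v0 trmx0.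
have := pos k x v^T Wx vT0.
by rewrite /gdot trmxK vg mul0mx mxE ltxx.
Qed.
Hint Resolve metric_unit : core.

Lemma csmooth_invg : csmooth k S (fun x => invmx (g k x)).
Proof. by apply: csmooth_inv => // x; exact: metric_unit. Qed.
Hint Resolve csmooth_invg : core.

Lemma invmetric_tr x : W x -> (invmx (g k x))^T = invmx (g k x).
Proof. by move=> Wx; rewrite trmx_inv metric_tr. Qed.

Lemma gdotC x X Y : W x -> gdot g k x X Y = gdot g k x Y X.
Proof.
move=> Wx; rewrite /gdot -[_ *m Y]tr_mx11 !trmx_mul trmxK metric_tr//.
by rewrite mulmxA.
Qed.

Lemma gdotDl x X Y Z : gdot g k x (X + Y) Z = gdot g k x X Z + gdot g k x Y Z.
Proof. by rewrite /gdot raddfD !mulmxDl mxE. Qed.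

Local Notation tproj := (tproj k g F).
Local Notation nproj := (nproj k g F).

Lemma tprojT x : W x -> tproj x *m T x = T x.
Proof.
by move=> Wx; rewrite /tproj -!mulmxA metricE// mulVmx ?mulmx1//; exact: metric_unit.
Qed.

Lemma adjT_tproj x : W x -> adjm ct (T x) *m tproj x = adjm ct (T x).
Proof.
by move=> Wx; rewrite /tproj !mulmxA metricE// mulmxV ?mul1mx//; exact: metric_unit.
Qed.

Lemma nprojT x : W x -> nproj x *m T x = 0.
Proof. by move=> Wx; rewrite nproj.unlock mulmxBl mul1mx tprojT// subrr. Qed.

Lemma adjT_nproj x : W x -> adjm ct (T x) *m nproj x = 0.
Proof. by move=> Wx; rewrite nproj.unlock mulmxBr mulmx1 adjT_tproj// subrr. Qed.

Lemma nproj_normal x a (B : 'M[R]_(N, a)) : adjm ct (T x) *m B = 0 ->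
  nproj x *m B = B.
Proof.
by move=> TB; rewrite nproj.unlock mulmxBl mul1mx /tproj -!mulmxA TB !mulmx0 subr0.
Qed.

Lemma adj_nproj x a (A : 'M[R]_(N, a)) : W x ->
  adjm ct (nproj x *m A) = adjm ct A *m nproj x.
Proof.
move=> Wx; rewrite nproj.unlock mulmxBl mul1mx mulmxBr mulmx1 adjmD adjmN; congr (_ - _).
rewrite /tproj -!mulmxA adjmM trmx_mul invmetric_tr// tr_adjmM.
by rewrite !mulmxA.
Qed.

Lemma adj_nproj2 x a b (A : 'M[R]_(N, a)) (B : 'M[R]_(N, b)) : W x ->
  adjm ct A *m (nproj x *m B) = adjm ct (nproj x *m A) *m (nproj x *m B).
Proof.
move=> Wx; rewrite adj_nproj// -mulmxA [in RHS]nproj_normal//.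
by rewrite mulmxA adjT_nproj// mul0mx.
Qed.

Lemma csmooth_tproj : csmooth k S tproj.
Proof. by smoothness. Qed.

(** Differentiate <F, F> = 1 / ct. The factor ct covers the flat case, where
    nothing is known about F itself. *)
Lemma position_normal x : W x -> ct *: (adjm ct (T x) *m F x) = 0.
Proof.
move=> Wx; have [ct0|ct0] := eqVneq ct 0; first by rewrite [X in X *: _]ct0 scale0r.
rewrite (_ : _ *m _ = 0) ?scaler0//; apply: trmx_inj; rewrite trmx0 tr_adjmM.
apply: mulmx_cV_inj => X; rewrite mul0mx -mulmxA (jac_mul _ sF)//.
have cst y : W y -> adjm ct (F y) *m F y = ct^-1%:M.
  move=> [ky Sy]; case: hI => _ _ _ /(_ y Sy)/(_ ct0) Fy _.
  by rewrite [LHS]mx11_scalar -Fy /adot adjmE.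
have := dir_eq oS X cst Wx; rewrite dir_cst (dirM (S:=S))//; last exact: csmooth_adj.
rewrite (dir_adj ct oS)// -[adjm ct (pdir _ _ _ _) *m _]tr_mx11 tr_adjmM.
move=> /eqP; rewrite -mulr2n -scaler_nat scaler_eq0 pnatr_eq0/=.
by move=> /eqP.
Qed.

(** The Levi-Civita connection is the tangential part of the flat derivative:
    as g = T^ T and D_X T Y is symmetric in X and Y, the derivatives of g in the
    Koszul formula add up to 2 T^ (D_X T) Y. *)
Lemma christoffelE x X : W x ->
  \matrix_(a, j) (\sum_i X i 0 * christoffel g k x a i j) =
  invmx (g k x) *m (adjm ct (T x) *m pdir k X T x).
Proof.
move=> Wx.
pose C i : 'M_n := adjm ct (T x) *m pdir k (delta_mx i 0) T x.
have Csym b i j : C i b j = C j b i.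
  have : C i *m delta_mx j 0 = C j *m delta_mx i (0 : 'I_1).
    by rewrite /C -!mulmxA (dir_jac_sym oS _ _ sF Wx).
  by rewrite -!colE => /matrixP/(_ b 0); rewrite !mxE.
have dg i j b : pdir k (delta_mx i 0) (g k) x j b = C i b j + C i j b.
  have E y : W y -> g k y = adjm ct (T y) *m T y by move=> Wy; rewrite metricE.
  rewrite (dir_eq oS _ E Wx) (dirM (S:=S))//; last exact: csmooth_adj.
  by rewrite (dir_adj ct oS)// -[adjm ct (pdir _ _ _ _) *m _]trmxK tr_adjmM !mxE.
have chE i a j : christoffel g k x a i j = (invmx (g k x) *m C i) a j.
  rewrite /christoffel mulr_sumr mxE; apply: eq_bigr => b _ /=; rewrite !dir_pdir.
  rewrite !dg (Csym b j i) (Csym j i b) (Csym i b j).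
  by field.
rewrite (dir_sum X sT Wx) !mulmx_sumr; apply/matrixP => a j.
rewrite summxE mxE; apply: eq_bigr => i _.
by rewrite chE -!scalemxAr [RHS]mxE.
Qed.

Lemma nablaE q x X (Y : M -> 'M[R]_(n, q)) : csmooth k S Y -> W x ->
  nabla g k X Y x =
  invmx (g k x) *m (adjm ct (T x) *m pdir k X (fun y => T y *m Y y) x).
Proof.
move=> sY Wx; rewrite /nabla dir_pdir christoffelE// (dirM (S:=S))// !mulmxDr addrC.
congr (_ + _); first by rewrite !mulmxA.
by rewrite (mulmxA (adjm _ _)) metricE// mulKmx//; exact: metric_unit.
Qed.

Lemma nabla_cstE x X Y : W x ->
  nabla g k X (fun=> Y) x =
  invmx (g k x) *m (adjm ct (T x) *m (pdir k X T x *m Y)).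
Proof.
by move=> Wx; rewrite nablaE//; [rewrite (dirMr oS)|exact: csmooth_cst].
Qed.

Lemma alphaE x X Y : W x -> alpha g F k X Y x =
  nproj x *m (pdir k X T x *m Y)
  + (ct * gdot g k x X Y) *: F x.
Proof.
move=> Wx; rewrite /alpha dir_pdir jac_jacm nabla_cstE// (dirMr oS)//.
by rewrite nproj.unlock mulmxBl mul1mx /tproj !mulmxA.
Qed.

(** Moving the derivative from the tangent frame to the normal vector, this is
    the Weingarten formula. *)
Lemma shape_opE x X (xi : 'cV[R]_N) : W x ->
  adjm ct (T x) *m xi = 0 -> ct *: (adjm ct (F x) *m xi) = 0 ->
  shape_op g F k x xi *m X = invmx (g k x) *m (adjm ct (pdir k X T x) *m xi).
Proof.
move=> Wx Txi Fxi; rewrite /shape_op -mulmxA; congr (_ *m _).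
apply/colP => j; rewrite mxE.
rewrite (dir_sum X sT Wx) adjm_sum mulmx_suml summxE.
apply: eq_bigr => i _; rewrite mxE mulrC adjmZ -scalemxAl [RHS]mxE.
congr (_ * _); rewrite /adot adjmE alphaE// adjmD adjmZ mulmxDl.
rewrite adj_nproj// -mulmxA nproj_normal// -scalemxAl mulrC -scalerA Fxi.
by rewrite scaler0 addr0 adjmM trmx_delta -mulmxA -rowE mxE.
Qed.

Section Data.
Context {m : nat} (phi : M -> 'cV[R]_m) (beta : M -> 'M[R]_(N, m)).
Hypothesis sphi : csmooth k S phi.
Hypothesis sbeta : csmooth k S beta.
Hypothesis Tbeta : forall x, W x -> adjm ct (T x) *m beta x = 0.
Hypothesis Fbeta : forall x, W x -> ct *: (adjm ct (F x) *m beta x) = 0.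

Local Notation gradm := (gradm k g phi).
Local Notation chartG := (chartG k g F phi beta).

Lemma omega_tE x : omega_t g phi k x = gradm x.
Proof. by rewrite /omega_t jac_jacm. Qed.

Lemma csmooth_gradm : csmooth k S gradm.
Proof. by smoothness. Qed.

Lemma csmooth_chartG : csmooth k S chartG.
Proof. by rewrite chartG.unlock; smoothness. Qed.

Lemma adjT_chartG x : W x -> adjm ct (T x) *m chartG x = (jacm k phi x)^T.
Proof.
move=> Wx; rewrite chartG.unlock !mulmxDr Tbeta// addr0 mulmxA metricE//.
rewrite mulKVmx; last exact: metric_unit.
by rewrite -scalemxAr mulmxA scalemxAl position_normal// mul0mx addr0.
Qed.

Lemma position_sq x : W x -> ct *: (ct *: (adjm ct (F x) *m F x)) = ct%:M.
Proof.
move=> [kx Sx]; have [ct0|ct0] := eqVneq ct 0.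
  by rewrite [X in X *: _]ct0 [X in X%:M]ct0 scale0r -scalemx1 scale0r.
case: hI => _ _ _ /(_ x Sx)/(_ ct0) Fx _.
rewrite [_ *m F x]mx11_scalar; move: Fx; rewrite /adot adjmE => ->.
by rewrite -[_^-1%:M]scalemx1 -[RHS]scalemx1 !scalerA -mulrA divff// mulr1.
Qed.

Lemma adjF_chartG x : W x -> ct *: (adjm ct (F x) *m chartG x) = ct *: (phi x)^T.
Proof.
move=> Wx; rewrite chartG.unlock !mulmxDr !scalerDr Fbeta// addr0.
rewrite mulmxA scalemxAl -[X in _ *: X]trmxK tr_adjmM -linearZ /= position_normal//.
rewrite trmx0 mul0mx add0r -scalemxAr mulmxA.
rewrite (_ : ct *: _ = ct *: (ct *: (adjm ct (F x) *m F x)) *m (phi x)^T).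
  by rewrite position_sq// mul_scalar_mx.
by rewrite !scalemxAl.
Qed.

Lemma dir_adjT_normal x X : W x ->
  adjm ct (pdir k X T x) *m beta x = - (adjm ct (T x) *m pdir k X beta x).
Proof.
move=> Wx; have := dir_eq oS X Tbeta Wx.
rewrite dir_cst (dirM (S:=S))//; last exact: csmooth_adj.
by rewrite (dir_adj ct oS)// => /eqP; rewrite addr_eq0 => /eqP.
Qed.

Lemma dir_chartG x X : W x -> pdir k X chartG x =
  pdir k X (fun y => T y *m gradm y) x + pdir k X beta x +
  ct *: (T x *m X *m (phi x)^T + F x *m (jacm k phi x *m X)^T).
Proof.
move=> Wx; have sG := csmooth_gradm.
rewrite chartG.unlock (dirD (S:=S))//; [|by smoothness..].
rewrite (dirD (S:=S))//; [|by smoothness..].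
rewrite (dirZ (S:=S))//; [|by smoothness..].
rewrite (dirM (S:=S) (A := F) (B := fun y => (phi y)^T))//; [|by smoothness..].
by rewrite dir_tr !(jac_mul (S:=S)).
Qed.

Lemma adjT_dir_chartG x X : W x -> adjm ct (T x) *m pdir k X chartG x =
  adjm ct (T x) *m pdir k X (fun y => T y *m gradm y) x +
  adjm ct (T x) *m pdir k X beta x + ct *: (g k x *m X *m (phi x)^T).
Proof.
move=> Wx; rewrite dir_chartG// !mulmxDr -scalemxAr mulmxDr scalerDr.
have -> : ct *: (adjm ct (T x) *m (F x *m (jacm k phi x *m X)^T)) = 0.
  by rewrite mulmxA scalemxAl position_normal// mul0mx.
by rewrite addr0 !mulmxA metricE.
Qed.

(** The three terms of Phi are the tangential parts of the derivatives of the
    three summands of calG. *)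
Lemma PhiE x X v : W x -> Phi g F phi beta k x X v =
  invmx (g k x) *m (adjm ct (T x) *m pdir k X chartG x) *m v.
Proof.
move=> Wx; have sG := csmooth_gradm.
rewrite /Phi adjT_dir_chartG//.
have sY : csmooth k S (fun y => omega_t g phi k y *m v).
  apply: (csmooth_eq oS (A := fun y => gradm y *m v)); last by smoothness.
  by move=> y _; rewrite omega_tE.
rewrite (nablaE X sY Wx).
have E y : W y -> T y *m (omega_t g phi k y *m v) = T y *m gradm y *m v.
  by rewrite omega_tE mulmxA.
rewrite (dir_eq oS _ E Wx) (dirMr oS)//; last by smoothness.
rewrite shape_opE//; first last.
- by rewrite mulmxA scalemxAl Fbeta// mul0mx.
- by rewrite mulmxA Tbeta// mul0mx.
rewrite !mulmxDr !mulmxDl; congr (_ + _ + _).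
- by rewrite !mulmxA.
- by rewrite (mulmxA (adjm _ _)) dir_adjT_normal// mulNmx mulmxN opprK !mulmxA.
rewrite -scalemxAr -!scalemxAl -scalerA; congr (_ *: _).
rewrite -!mulmxA mulKmx; last exact: metric_unit.
by rewrite [_ *m v]mx11_scalar mul_mx_scalar mxE.
Qed.

(** Likewise the first Ribaucour condition says that the derivative of calG is
    tangent to the immersion. The term ct <X, w^t v> F in [alpha] is the
    derivative of phi in the summand ct F phi^T. *)
Lemma normal_eqE x X v : W x ->
  alpha g F k X (omega_t g phi k x *m v) x
  + nabla_perp g F k X (fun y => beta y *m v) x =
  nproj x *m pdir k X chartG x *m v.
Proof.
move=> Wx; have sG := csmooth_gradm.
rewrite alphaE// /nabla_perp dir_pdir jac_jacm shape_opE//; first last.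
- by rewrite mulmxA scalemxAl Fbeta// mul0mx.
- by rewrite mulmxA Tbeta// mul0mx.
rewrite (dirMr oS)// (mulmxA (adjm _ _)) dir_adjT_normal//.
have -> : pdir k X beta x *m v +
    T x *m (invmx (g k x) *m (- (adjm ct (T x) *m pdir k X beta x) *m v))
    = nproj x *m pdir k X beta x *m v.
  by rewrite nproj.unlock /tproj mulNmx !mulmxN mulmxBl mul1mx mulmxBl !mulmxA.
have -> : gdot g k x X (omega_t g phi k x *m v) = ((jacm k phi x *m X)^T *m v) 0 0.
  rewrite /gdot omega_tE /gradm trmx_mul -!mulmxA mulKVmx//.
  exact: metric_unit.
rewrite dir_chartG// (dirM (S:=S))// omega_tE !mulmxDr -scalemxAr mulmxDr.
rewrite !(mulmxA (nproj x) (T x)) nprojT// mul0mx addr0 (mulmxA (nproj x) (T x *m X)).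
rewrite (mulmxA (nproj x) (T x)) nprojT// !mul0mx add0r.
have -> : ct *: (nproj x *m (F x *m (jacm k phi x *m X)^T)) =
    ct *: (F x *m (jacm k phi x *m X)^T).
  rewrite scalemxAr nproj_normal// -scalemxAr mulmxA scalemxAl.
  by rewrite position_normal// mul0mx.
rewrite !mulmxDl -!scalemxAl -scalerA !mulmxA addrAC; congr (_ + _ *: _).
by rewrite -mulmxA [_^T *m v]mx11_scalar mul_mx_scalar mxE.
Qed.

End Data.

(** Compare the derivatives of T^ (tproj B) and of T^ B, which are equal. *)
Lemma dir_proj x X (B : M -> 'cV[R]_N) : csmooth k S B -> W x ->
  adjm ct (T x) *m pdir k X (fun y => tproj y *m B y) x =
  adjm ct (T x) *m pdir k X B x + adjm ct (pdir k X T x) *m (nproj x *m B x).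
Proof.
move=> sB Wx; have sP := csmooth_tproj.
have E y : W y -> adjm ct (T y) *m (tproj y *m B y) = adjm ct (T y) *m B y.
  by move=> Wy; rewrite mulmxA adjT_tproj.
have := dir_eq oS X E Wx.
rewrite (dirM (S:=S))//; [|by smoothness..].
rewrite [RHS](dirM (S:=S))//; [|by smoothness..].
rewrite (dir_adj ct oS)// => /eqP; rewrite addrC eq_sym -subr_eq eq_sym => /eqP ->.
by rewrite addrAC -mulmxBr nproj.unlock mulmxBl mul1mx addrC.
Qed.

(** The Gauss equation. Second derivatives of T occur symmetrically in X and Y
    and cancel in the commutator; the normal parts come from differentiating
    the projection onto the tangent space. In this form the normal part is taken
    in the flat ambient space, so the component along F accounts for ct. *)
Lemma curvatureE x X Y Z V : W x ->
  gdot g k x (curvature g k X Y Z x) V =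
  ip ct (nproj x *m (pdir k X T x *m V)) (nproj x *m (pdir k Y T x *m Z)) -
  ip ct (nproj x *m (pdir k Y T x *m V)) (nproj x *m (pdir k X T x *m Z)).
Proof.
move=> Wx.
have H X' Y' : V^T *m g k x *m nabla g k X' (nabla g k Y' (fun=> Z)) x =
    V^T *m (adjm ct (T x) *m (pdir k X' (pdir k Y' T) x *m Z)) +
    adjm ct (pdir k X' T x *m V) *m (nproj x *m (pdir k Y' T x *m Z)).
  have sD := csmooth_dir oS Y' sT.
  pose E y := pdir k Y' T y *m Z; have sE : csmooth k S E by smoothness.
  have sN : csmooth k S (nabla g k Y' (fun=> Z)).
    apply: (csmooth_eq oS
      (A := fun y => invmx (g k y) *m (adjm ct (T y) *m E y))).
      by move=> y Wy; rewrite nabla_cstE.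
    by smoothness.
  rewrite (nablaE X' sN Wx) -!mulmxA mulKVmx//; last exact: metric_unit.
  have Ey y : W y -> T y *m nabla g k Y' (fun=> Z) y = tproj y *m E y.
    by move=> Wy; rewrite nabla_cstE// /tproj !mulmxA.
  rewrite (dir_eq oS _ Ey Wx) dir_proj// mulmxDr adjmM -!mulmxA; congr (_ + _).
  by rewrite /E (dirMr oS).
rewrite /gdot /curvature.
have -> (A : 'cV[R]_n) : (A^T *m g k x *m V) = V^T *m g k x *m A.
  by rewrite -[LHS]tr_mx11 !trmx_mul trmxK metric_tr// mulmxA.
rewrite mulmxBr !H (dir_comm oS X Y sT Wx) opprD addrACA subrr add0r.
by rewrite /ip -!adj_nproj2// mx_addE mx_oppE.
Qed.

End Geometry.

(** * L-transforms in matrix form *)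
Section Reduced.
Context {R : realType} {n p : nat} (c : R) {ct : R} {M : manifold R n}.
Local Notation N := (ambient_dim n p ct).
Context (S : set M) (g : metric_field M) (F : M -> 'cV[R]_N).
Context {m : nat} (phi : M -> 'cV[R]_m) (beta : M -> 'M[R]_(N, m)).
Context (Omega : M -> 'M[R]_m) (L : 'M[R]_m).
Implicit Types (k l : chart M) (x y : M) (X Y : 'cV[R]_n).

(** The conditions for an L-transform at a point of a chart, rewritten with the
    flat derivative of G. *)
Record reduced_data k x : Prop := ReducedData {
  red_Tbeta : adjm ct (jacm k F x) *m beta x = 0;
  red_Fbeta : ct *: (adjm ct (F x) *m beta x) = 0;
  red_dG : forall X, nproj k g F x *m pdir k X (chartG k g F phi beta) x = 0;
  red_comm : forall X u v,
    let P X := invmx (g k x) *m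
      (adjm ct (jacm k F x) *m pdir k X (chartG k g F phi beta) x) in
    P (P X *m v) *m u = P (P X *m u) *m v;
  red_unit : Omega x \in unitmx;
  red_dOmega : forall X, pdir k X Omega x =
    adjm ct (chartG k g F phi beta x) *m pdir k X (chartG k g F phi beta) x;
  red_Omega : Omega x + (Omega x)^T =
    adjm ct (chartG k g F phi beta x) *m chartG k g F phi beta x;
  red_L1 : forall X, invmx (g k x) *m
      (adjm ct (jacm k F x) *m pdir k X (chartG k g F phi beta) x) *m L =
    invmx (g k x) *m (adjm ct (jacm k F x) *m pdir k X beta x)
      - (c - ct) *: (X *m (phi x)^T);
  red_L2 : Omega x *m L + L^T *m (Omega x)^T =
    adjm ct (beta x) *m beta x - (c - ct) *: (phi x *m (phi x)^T) }.

(** Independence of the chart: a change of coordinates with Jacobian J turns g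
    into J^T g J and dF, dphi into dF J, dphi J, and J cancels. *)
Lemma calGE k x : isometric_immersion S g F -> smooth S phi ->
  (cdom k `&` S) x -> calG g F phi beta x = chartG k g F phi beta x.
Proof.
move=> hI sphi [kx Sx]; rewrite /calG chartG.unlock jac_jacm omega_tE.
congr (_ + _ + _).
have := chart_atP x; move: (chart_at x) => l lx.
have oS := immersion_open hI; have sF := immersion_smooth (k := k) hI.
have Wx : (cdom l `&` cdom k `&` S) x by [].
have chF := jac_change oS sF Wx.
have chphi := jac_change oS (sphi k) Wx.
have gl : g l x = (jacm l (cmap k) x)^T *m g k x *m jacm l (cmap k) x.
  by case: hI => _ [_ _ _ /(_ l k x Wx)] + _ _ _; rewrite jac_jacm.
have ul : g l x \in unitmx by apply: (metric_unit hI).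
have uk : g k x \in unitmx by apply: (metric_unit hI).
move: gl chF chphi; rewrite /gradm; move: (jacm l (cmap k) x) => J gl -> ->.
have uJ : J \in unitmx by move: ul; rewrite gl !unitmx_mul => /andP[].
have uJT : J^T \in unitmx by rewrite unitmx_tr.
rewrite gl trmx_mul -!mulmxA; congr (_ *m _).
set z := RHS; have zE : (jacm k phi x)^T = g k x *m (J *m (invmx J *m z)).
  by rewrite mulKVmx// /z mulKVmx.
have hE w : J^T *m (g k x *m (J *m w)) = J^T *m (g k x *m J) *m w :> 'M_(_, m).
  by rewrite !mulmxA.
by rewrite zE hE mulKmx ?mulKVmx// mulmxA -gl.
Qed.

Lemma L_transform_reduced k x : L_transform_data c S g F phi beta Omega L ->
  (cdom k `&` S) x -> reduced_data k x.
Proof.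
move=> [hI _ [sphi sbeta sOmega nrm data] hL1 hL2] Wx; have [kx Sx] := Wx.
have oS := immersion_open hI; have sF := immersion_smooth (k := k) hI.
have Tb y : (cdom k `&` S) y -> adjm ct (jacm k F y) *m beta y = 0.
  by move=> /(nrm k)[+ _]; rewrite adjmE jac_jacm.
have Fb y : (cdom k `&` S) y -> ct *: (adjm ct (F y) *m beta y) = 0.
  move=> /(nrm k)[_]; have [ct0 _|ct0 /(_ isT)] := eqVneq ct 0.
    by rewrite [X in X *: _]ct0 scale0r.
  by rewrite adjmE => ->; rewrite scaler0.
have GE y : (cdom k `&` S) y -> calG g F phi beta y = chartG k g F phi beta y.
  exact: calGE.
have dGE X := dir_eq oS X GE Wx.
have PE X v := PhiE hI (sphi k) (sbeta k) Tb Fb X v Wx.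
have [d1 d2 d3 d4 d5] := data k x Wx.
split=> //.
- exact: Tb.
- exact: Fb.
- move=> X; apply: mulmx_cV_inj => v; rewrite mul0mx.
  by rewrite -(normal_eqE hI (sphi k) (sbeta k) Tb Fb X v Wx).
- move=> X u v P; apply/eqP; rewrite -subr_eq0; apply/eqP.
  by have := d2 X u v; rewrite !PE.
- by move=> X; rewrite -dGE -GE// -dir_pdir d4 adjmE dir_pdir.
- by rewrite -GE// -adjmE.
- move=> X; apply: mulmx_cV_inj => v.
  have := hL1 k x X v Wx; rewrite PE (shape_opE hI)//; first last.
  + by rewrite mulmxA scalemxAl Fb// mul0mx.
  + by rewrite mulmxA Tb// mul0mx.
  rewrite (mulmxA (adjm _ _)) (dir_adjT_normal hI (sbeta k) Tb)//.
  move=> /eqP; rewrite -addrA addr_eq0 => /eqP H; rewrite -[LHS]mulmxA H.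
  rewrite mulmxBl opprD mulNmx mulmxN opprK mulmxA -scalemxAl -scalerA.
  rewrite -[X *m _ *m v]mulmxA [_ *m v in RHS]mx11_scalar mul_mx_scalar.
  by rewrite !mulmxA.
- by rewrite hL2// adjmE.
Qed.

Lemma reduced_L_transform : isometric_immersion S g F -> constant_curvature S g c ->
  smooth S phi -> smooth S beta -> smooth S Omega ->
  (forall k x, (cdom k `&` S) x -> reduced_data k x) ->
  L_transform_data c S g F phi beta Omega L.
Proof.
move=> hI hc sphi sbeta sOmega red.
have oS := immersion_open hI.
have Tb k y : (cdom k `&` S) y -> adjm ct (jacm k F y) *m beta y = 0.
  by move=> /red/red_Tbeta.
have Fb k y : (cdom k `&` S) y -> ct *: (adjm ct (F y) *m beta y) = 0.
  by move=> /red/red_Fbeta.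
have GE k y : (cdom k `&` S) y -> calG g F phi beta y = chartG k g F phi beta y.
  exact: calGE.
have dGE k x X Wx := dir_eq (x := x) oS X (@GE k) Wx.
have PE k x X v Wx := PhiE hI (sphi k) (sbeta k) (@Tb k) (@Fb k) (x := x) X v Wx.
split=> //; first split=> //.
- move=> k x Wx; split; first by rewrite adjmE jac_jacm Tb.
  by move=> ct0; rewrite adjmE; have /eqP := Fb k x Wx;
    rewrite scaler_eq0 (negbTE ct0) => /eqP.
- move=> k x Wx; have r := red k x Wx; split.
  + move=> X v; rewrite (normal_eqE hI (sphi k) (sbeta k) (@Tb k) (@Fb k) X v Wx).
    by rewrite (red_dG r) mul0mx.
  + by move=> X u v; rewrite !PE// (red_comm r) subrr.
  + exact: red_unit r.
  + by move=> X; rewrite dir_pdir (red_dOmega r) adjmE dir_pdir (dGE k)// (GE k).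
  + by rewrite (red_Omega r) adjmE (GE k).
- move=> k x X v Wx; have r := red k x Wx.
  rewrite PE// (shape_opE hI)//; first last.
  + by rewrite mulmxA scalemxAl (Fb k)// mul0mx.
  + by rewrite mulmxA (Tb k)// mul0mx.
  rewrite (mulmxA (adjm _ _)) (dir_adjT_normal hI (sbeta k) (@Tb k))// mulmxA (red_L1 r).
  rewrite mulmxBl mulNmx mulmxN !mulmxA [X in X + _]addrAC subrr add0r.
  rewrite -scalemxAl -mulmxA [_ *m v in X in - X + _]mx11_scalar mul_mx_scalar.
  by rewrite scalerA addNr.
- move=> x Sx; have r := red (chart_at x) x (conj (chart_atP x) Sx).
  by rewrite (red_L2 r) adjmE.
Qed.

Lemma constant_curvatureE : isometric_immersion S g F ->
  constant_curvature S g c <-> forall k x X Y, (cdom k `&` S) x ->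
    ip ct (nproj k g F x *m (pdir k X (jacm k F) x *m X))
        (nproj k g F x *m (pdir k Y (jacm k F) x *m Y)) -
    ip ct (nproj k g F x *m (pdir k Y (jacm k F) x *m X))
        (nproj k g F x *m (pdir k X (jacm k F) x *m Y)) =
    c * (gdot g k x X X * gdot g k x Y Y - gdot g k x X Y ^+ 2).
Proof.
move=> hI; split=> H k x X Y Wx.
  by rewrite -(curvatureE hI)// H.
by rewrite (curvatureE hI)// H.
Qed.

End Reduced.

(** * The algebra of one transform *)

(** [transPd] is the adjoint of [transP], and under the relation of G, Omega
    and Q its inverse. *)
HB.lock Definition transP (R : realType) (ct : R) (N m : nat) (G : 'M[R]_(N, m))
  (Q : 'M[R]_m) : 'M[R]_N := 1%:M - G *m Q *m adjm ct G.

HB.lock Definition transPd (R : realType) (ct : R) (N m : nat) (G : 'M[R]_(N, m))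
  (Q : 'M[R]_m) : 'M[R]_N := 1%:M - G *m Q^T *m adjm ct G.

Section TransformAlgebra.
Context {R : realType} (ct : R) {N m : nat}.
Context (G : 'M[R]_(N, m)) (Om Q : 'M[R]_m).

Local Notation transP := (transP ct G Q).
Local Notation transPd := (transPd ct G Q).

Lemma adj_transP a (A : 'M[R]_(N, a)) :
  adjm ct (transP *m A) = adjm ct A *m transPd.
Proof.
rewrite transP.unlock transPd.unlock mulmxBl mul1mx mulmxBr mulmx1 adjmD adjmN; congr (_ - _).
by rewrite -!mulmxA adjmM trmx_mul tr_adjmM !mulmxA.
Qed.

Hypothesis GG : Om + Om^T = adjm ct G *m G.
Hypothesis QtOQ : Q^T *m Om *m Q = Q^T.
Hypothesis QOQt : Q *m Om *m Q^T = Q^T.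

Lemma QtOtQ : Q^T *m Om^T *m Q = Q.
Proof. by apply: trmx_inj; rewrite !trmx_mul !trmxK mulmxA. Qed.

Lemma QOtQt : Q *m Om^T *m Q^T = Q.
Proof. by apply: trmx_inj; rewrite !trmx_mul !trmxK mulmxA. Qed.

(** In the product, G^ G = Omega + Omega^T occurs between Q^T and Q, where it
    gives Q^T + Q. *)
Lemma transPdP : transPd *m transP = 1%:M.
Proof.
rewrite transP.unlock transPd.unlock mulmxBl mul1mx mulmxBr mulmx1.
have -> : G *m Q^T *m adjm ct G *m (G *m Q *m adjm ct G) =
    G *m (Q^T *m (adjm ct G *m G) *m Q) *m adjm ct G by rewrite !mulmxA.
rewrite -GG mulmxDr mulmxDl QtOQ QtOtQ; mxnf; mxlin.
Qed.

Lemma transPPd : transP *m transPd = 1%:M.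
Proof. exact: mulmx1C transPdP. Qed.

Lemma adj_transP2 a b (A : 'M[R]_(N, a)) (B : 'M[R]_(N, b)) :
  adjm ct (transP *m A) *m (transP *m B) = adjm ct A *m B.
Proof. by rewrite adj_transP -!mulmxA (mulmxA transPd) transPdP mul1mx. Qed.

Lemma transP_G : transP *m (G *m (1%:M - Q^T *m Om^T)) = G *m (1%:M - Q *m Om).
Proof.
have PG : transP *m G = G *m (1%:M - Q *m (Om + Om^T)).
  by rewrite transP.unlock GG mulmxBl mul1mx mulmxBr mulmx1 !mulmxA.
rewrite mulmxA PG -mulmxA; congr (G *m _).
rewrite mulmxBl mul1mx !mulmxBr mulmx1.
have -> : Q *m (Om + Om^T) *m (Q^T *m Om^T) =
    (Q *m Om *m Q^T + Q *m Om^T *m Q^T) *m Om^T.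
  by rewrite mulmxDr !mulmxDl !mulmxA.
rewrite QOQt QOtQt; mxnf; mxlin.
Qed.

Lemma transPd_GQ : transPd *m (G *m Q) = - (G *m Q^T).
Proof.
rewrite transPd.unlock mulmxBl mul1mx.
have -> : G *m Q^T *m adjm ct G *m (G *m Q) =
    G *m (Q^T *m (adjm ct G *m G) *m Q) by rewrite !mulmxA.
rewrite -GG mulmxDr mulmxDl QtOQ QtOtQ; mxnf; mxlin.
Qed.

(** The Schur complement of Omega can be written as a congruence of Omega, and
    so Omega' + Omega'^T is B^T (Omega + Omega^T) B. *)
Lemma OmB_sym : (1%:M - Om *m Q) *m Om *m (1%:M - Q^T *m Om^T) = Om - Om *m Q *m Om.
Proof.
rewrite mulmxBr mulmx1 -[RHS]subr0 mulmxBl mul1mx; congr (_ - _).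
rewrite mulmxBl.
have -> : Om *m Q *m Om *m (Q^T *m Om^T) = Om *m (Q *m Om *m Q^T) *m Om^T.
  by rewrite !mulmxA.
by rewrite QOQt !mulmxA subrr.
Qed.

Context (L : 'M[R]_m).
Hypothesis LQ : L *m Q^T = Q *m Om *m L *m Q^T.

Lemma OmB_L : (Om - Om *m Q *m Om) *m L *m (1%:M - Q^T *m Om^T) =
  (Om - Om *m Q *m Om) *m L.
Proof.
rewrite mulmxBr mulmx1 -[RHS]subr0; congr (_ - _).
have -> : (Om - Om *m Q *m Om) *m L *m (Q^T *m Om^T) =
    Om *m (L *m Q^T - Q *m Om *m L *m Q^T) *m Om^T by mxnf.
by rewrite -LQ subrr mulmx0 mul0mx.
Qed.

(** The difference between C L and L B, multiplied by Phi, is what the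
    derivative of P contributes to that of P beta B; so this identity carries
    the first condition on L over to the transform. *)
Lemma L_identity (rho : 'M[R]_m) : Om *m L + L^T *m Om^T = rho ->
  (1%:M - Q *m Om) *m L - L *m (1%:M - Q^T *m Om^T)
  + Q *m rho *m (1%:M - Q^T *m Om^T) = 0.
Proof.
move=> <-.
have LQt : Q *m L^T = Q *m L^T *m Om^T *m Q^T.
  by apply: trmx_inj; rewrite !trmx_mul !trmxK {1}LQ !mulmxA.
rewrite !mulmxBl !mulmxBr !mulmx1 !mul1mx mulmxDr !mulmxDl.
rewrite (mulmxA L) LQ !mulmxA -LQt.
mxnf; mxlin.
Qed.

End TransformAlgebra.

(** A tensor with the symmetries of a curvature tensor is determined by its
    sectional curvatures. Additivity is enough, because the argument only
    expands sums of two vectors. *)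
Lemma curvature_polarization (R : realType) (V : zmodType) (E : V -> V -> V -> V -> R) :
  (forall X X' Y Z U, E (X + X') Y Z U = E X Y Z U + E X' Y Z U) ->
  (forall X Y Z U, E X Y Z U = - E Y X Z U) ->
  (forall X Y Z U, E X Y Z U = E Z U X Y) ->
  (forall X Y Z U, E X Y Z U + E Y Z X U + E Z X Y U = 0) ->
  (forall X Y, E X Y X Y = 0) -> forall X Y Z U, E X Y Z U = 0.
Proof.
move=> addE asym pair bianchi diag.
have add2 X Y Y' Z U : E X (Y + Y') Z U = E X Y Z U + E X Y' Z U.
  by rewrite asym addE opprD -!asym.
have add3 X Y Z Z' U : E X Y (Z + Z') U = E X Y Z U + E X Y Z' U.
  by rewrite pair addE !(pair _ _ X Y).
have add4 X Y Z U U' : E X Y Z (U + U') = E X Y Z U + E X Y Z U'.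
  by rewrite pair add2 !(pair _ _ X Y).
have A3 X Y Z : E X Y X Z = 0.
  have := diag X (Y + Z); rewrite add2 !add4 !diag [E X Z X Y]pair; lra.
have A13 X Y Z U : E X Y Z U = - E Z Y X U.
  have := A3 (X + Z) Y U; rewrite addE !add3 !A3; lra.
move=> X Y Z U; have := bianchi X Y Z U.
rewrite [E Y Z X U]A13 [E X Z Y U]asym [E Z X Y U]asym [E X Z Y U]A13.
rewrite [E Y Z X U]asym [E Z Y X U]A13; lra.
Qed.

Section InnerProduct.
Context {R : realType} (ct : R) {N : nat}.
Implicit Types A B : 'cV[R]_N.

(** The reason why the curvature is preserved. The contribution of the cross
    terms, - sa^T (L Q^T + Q L^T) sb, is cancelled by that of nu^ nu, since
    L Q^T = Q Omega L Q^T. The terms with phi complete ea * eb to the product of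
    the transformed metric coefficients. *)
Lemma ip_transformed m (nu : 'M[R]_(N, m)) (Om Q L : 'M[R]_m) (phi sa sb : 'cV[R]_m)
    A B c ea eb :
  adjm ct nu *m nu = Om *m L + L^T *m Om^T + c *: (phi *m phi^T) ->
  L *m Q^T = Q *m Om *m L *m Q^T ->
  adjm ct nu *m A = - (L^T *m sa) - (c * ea) *: phi ->
  adjm ct nu *m B = - (L^T *m sb) - (c * eb) *: phi ->
  let f s := (phi^T *m (Q^T *m s)) 0 0 in
  ip ct (A + nu *m (Q^T *m sa)) (B + nu *m (Q^T *m sb)) =
  ip ct A B + c * ((ea - f sa) * (eb - f sb) - ea * eb).
Proof.
move=> nunu LQ nuA nuB f.
have LQt : Q *m L^T = Q *m L^T *m Om^T *m Q^T.
  by apply: trmx_inj; rewrite !trmx_mul !trmxK {1}LQ !mulmxA.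
have Anu : adjm ct A *m nu = - (sa^T *m L) - (c * ea) *: phi^T.
  by rewrite -tr_adjmM nuA !mx_trE trmx_mul trmxK.
have fE s : phi^T *m (Q^T *m s) = (f s)%:M by rewrite [LHS]mx11_scalar.
have fE' s : s^T *m Q *m phi = (f s)%:M.
  by rewrite -[LHS]tr_mx11 !trmx_mul trmxK fE.
rewrite /ip adjmD adjmM trmx_mul trmxK !mulmxDl !mulmxDr.
rewrite (mulmxA (adjm ct A)) Anu -(mulmxA _ _ B) nuB.
have -> : sa^T *m Q *m adjm ct nu *m (nu *m (Q^T *m sb)) =
   sa^T *m Q *m (adjm ct nu *m nu) *m (Q^T *m sb) by rewrite !mulmxA.
rewrite nunu.
have -> : (- (sa^T *m L) - (c * ea) *: phi^T) *m (Q^T *m sb) =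
   - (sa^T *m (L *m Q^T) *m sb) - (c * ea * f sb)%:M.
  rewrite mulmxBl mulNmx -scalemxAl fE scale_scalar_mx; congr (- _ - _).
  by rewrite !mulmxA.
have -> : sa^T *m Q *m (- (L^T *m sb) - (c * eb) *: phi) =
   - (sa^T *m (Q *m L^T) *m sb) - (c * eb * f sa)%:M.
  rewrite mulmxBr mulmxN -scalemxAr fE' scale_scalar_mx; congr (- _ - _).
  by rewrite !mulmxA.
have -> : sa^T *m Q *m (Om *m L + L^T *m Om^T + c *: (phi *m phi^T)) *m (Q^T *m sb) =
   sa^T *m (Q *m Om *m L *m Q^T) *m sb + sa^T *m (Q *m L^T *m Om^T *m Q^T) *m sb
   + (c * f sa * f sb)%:M.
  rewrite !mulmxDr !mulmxDl; congr (_ + _ + _); try by rewrite !mulmxA.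
  rewrite -scalemxAr -scalemxAl (mulmxA _ phi) fE' -mulmxA fE -scalar_mxM.
  by rewrite scale_scalar_mx mulrA.
have sE a : (a%:M : 'M[R]_1) 0 0 = a by rewrite mxE eqxx mulr1n.
by rewrite -LQ -LQt !(mx_addE, mx_oppE, sE); ring.
Qed.

End InnerProduct.

Lemma invmx_congruence (R : realType) n d (D g : 'M[R]_n) (V : 'M[R]_(n, d)) :
  D \in unitmx -> g \in unitmx ->
  invmx (D^T *m g *m D) *m (D^T *m V) = invmx D *m (invmx g *m V).
Proof.
move=> uD ug.
have uDg : D^T *m g *m D \in unitmx by rewrite !unitmx_mul unitmx_tr uD ug.
have -> : D^T *m V = D^T *m g *m D *m (invmx D *m (invmx g *m V)).
  by rewrite -!mulmxA (mulKVmx uD) (mulKVmx ug).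
by rewrite mulKmx.
Qed.

Lemma csmooth_sub (R : realType) n (M : manifold R n) k (S S1 : set M) a b
  (A : M -> 'M[R]_(a, b)) : S1 `<=` S -> csmooth k S A -> csmooth k S1 A.
Proof.
move=> S1S sA s t r u [x [kx Sx] <-]; apply: sA.
by exists x => //; split=> //; exact: S1S.
Qed.

(** * The geometry of one transform *)
HB.lock Definition Phi_mx (R : realType) (n p : nat) (ct : R) (M : manifold R n)
    (g : metric_field M) (F : M -> 'cV[R]_(ambient_dim n p ct)) (m : nat)
    (phi : M -> 'cV[R]_m) (beta : M -> 'M[R]_(ambient_dim n p ct, m))
    (k : chart M) (X : 'cV[R]_n) (x : M) : 'M[R]_(n, m) :=
  invmx (g k x) *m (adjm ct (jacm k F x) *m pdir k X (chartG k g F phi beta) x).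

Definition transF (R : realType) (n p : nat) (ct : R) (M : manifold R n)
    (g : metric_field M) (F : M -> 'cV[R]_(ambient_dim n p ct)) (m : nat)
    (phi : M -> 'cV[R]_m) (beta : M -> 'M[R]_(ambient_dim n p ct, m))
    (Q : M -> 'M[R]_m) (x : M) : 'cV[R]_(ambient_dim n p ct) :=
  F x - calG g F phi beta x *m Q x *m phi x.

(** The matrix D with dF' = P T D. It is read off from F', rather than defined
    as X - Phi_X Q phi, so that its smoothness is immediate. *)
HB.lock Definition transD (R : realType) (n p : nat) (ct : R) (M : manifold R n)
    (g : metric_field M) (F : M -> 'cV[R]_(ambient_dim n p ct)) (m : nat)
    (phi : M -> 'cV[R]_m) (beta : M -> 'M[R]_(ambient_dim n p ct, m))
    (Q : M -> 'M[R]_m) (k : chart M) (x : M) : 'M[R]_n :=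
  invmx (g k x) *m (adjm ct (jacm k F x) *m
    (transPd ct (chartG k g F phi beta x) (Q x) *m
     jacm k (transF g F phi beta Q) x)).

(** The normal part of G in the flat ambient space. *)
HB.lock Definition normalG (R : realType) (n p : nat) (ct : R) (M : manifold R n)
    (F : M -> 'cV[R]_(ambient_dim n p ct)) (m : nat)
    (phi : M -> 'cV[R]_m) (beta : M -> 'M[R]_(ambient_dim n p ct, m)) (x : M) :
    'M[R]_(ambient_dim n p ct, m) :=
  beta x + ct *: (F x *m (phi x)^T).

(** For Q the inverse on V_j of the compression of Omega to V_j, the map 1 - Q Omega is the
    projection along V_j onto the vectors that Omega sends to the orthogonal
    complement of V_j, and 1 - Q^T Omega^T is the same for Omega^T. These are
    their restrictions to the columns of b. *)
HB.lock Definition transB (R : realType) (n : nat) (M : manifold R n) (m d : nat)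
    (Q Omega : M -> 'M[R]_m) (b : 'M[R]_(m, d)) (x : M) : 'M[R]_(m, d) :=
  b - (Q x)^T *m (Omega x)^T *m b.

HB.lock Definition transC (R : realType) (n : nat) (M : manifold R n) (m d : nat)
    (Q Omega : M -> 'M[R]_m) (b : 'M[R]_(m, d)) (x : M) : 'M[R]_(m, d) :=
  b - Q x *m Omega x *m b.

Section TransformGeometry.
Context {R : realType} {n p : nat} {c ct : R} {M : manifold R n}.
Local Notation N := (ambient_dim n p ct).
Context (S : set M) (g : metric_field M) (F : M -> 'cV[R]_N).
Context {m : nat} (phi : M -> 'cV[R]_m) (beta : M -> 'M[R]_(N, m)).
Context (Omega : M -> 'M[R]_m) (L : 'M[R]_m).
Hypothesis hL : L_transform_data c S g F phi beta Omega L.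
Context (Q : M -> 'M[R]_m).
Hypothesis sQ : smooth S Q.
Hypothesis QtOQ : forall x, S x -> (Q x)^T *m Omega x *m Q x = (Q x)^T.
Hypothesis QOQt : forall x, S x -> Q x *m Omega x *m (Q x)^T = (Q x)^T.
Hypothesis dQ : forall k x X, (cdom k `&` S) x ->
  pdir k X Q x = - (Q x *m pdir k X Omega x *m Q x).
Hypothesis LQ : forall x, S x ->
  L *m (Q x)^T = Q x *m Omega x *m L *m (Q x)^T.
Implicit Types (k l : chart M) (x y : M) (X Y Z U : 'cV[R]_n).

Let hI : isometric_immersion S g F. Proof. by case: hL. Qed.
Let oS : open S. Proof. exact: immersion_open hI. Qed.
Let sF k : csmooth k S F. Proof. exact: immersion_smooth hI. Qed.
Let sphi k : csmooth k S phi. Proof. by case: hL => _ _ [+ _ _ _ _] _ _; apply. Qed.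
Let sbeta k : csmooth k S beta. Proof. by case: hL => _ _ [_ + _ _ _] _ _; apply. Qed.
Let sOm k : csmooth k S Omega. Proof. by case: hL => _ _ [_ _ + _ _] _ _; apply. Qed.
Let sQk k : csmooth k S Q. Proof. exact: sQ. Qed.
Let red k x (Wx : (cdom k `&` S) x) := L_transform_reduced hL Wx.
Let Tbeta k x (Wx : (cdom k `&` S) x) := red_Tbeta (red Wx).
Let Fbeta k x (Wx : (cdom k `&` S) x) := red_Fbeta (red Wx).

Arguments sF : clear implicits.
Arguments sphi : clear implicits.
Arguments sbeta : clear implicits.
Arguments sOm : clear implicits.
Arguments sQk : clear implicits.

Local Notation G k := (chartG k g F phi beta).
Local Notation T k := (jacm k F).
Local Notation transF := (transF g F phi beta Q).
Local Notation Phi_mx := (Phi_mx g F phi beta).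
Local Notation transD := (transD g F phi beta Q).
Local Notation P k x := (transP ct (G k x) (Q x)).
Local Notation Pd k x := (transPd ct (G k x) (Q x)).

Let sG k : csmooth k S (G k).
Proof. exact: (csmooth_chartG hI (sphi k) (sbeta k)). Qed.

Arguments sG : clear implicits.

Lemma dir_chartG_tangent k X x : (cdom k `&` S) x -> pdir k X (G k) x = T k x *m Phi_mx k X x.
Proof.
move=> Wx; have := red_dG (red Wx) X.
by rewrite nproj.unlock mulmxBl mul1mx => /eqP; rewrite subr_eq0 => /eqP ->;
  rewrite /tproj Phi_mx.unlock !mulmxA.
Qed.

Lemma adjG_T k x : (cdom k `&` S) x -> adjm ct (G k x) *m T k x = jacm k phi x.
Proof.
move=> Wx; apply: trmx_inj; rewrite tr_adjmM.
exact: (adjT_chartG hI phi (@Tbeta k)).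
Qed.

Lemma adjG_F k x : (cdom k `&` S) x ->
  ct *: (adjm ct (G k x) *m F x) = ct *: phi x.
Proof.
move=> Wx; apply: trmx_inj; rewrite !linearZ /= tr_adjmM.
exact: (adjF_chartG hI phi (@Fbeta k)).
Qed.

Let GG k x : (cdom k `&` S) x ->
  Omega x + (Omega x)^T = adjm ct (G k x) *m G k x.
Proof. by move=> Wx; exact: red_Omega (red Wx). Qed.

Let PdP k x (Wx : (cdom k `&` S) x) : Pd k x *m P k x = 1%:M.
Proof. by case: (Wx) => _ Sx; exact: transPdP (GG Wx) (QtOQ Sx). Qed.

Lemma transFE k x : (cdom k `&` S) x ->
  transF x = F x - G k x *m Q x *m phi x.
Proof. by move=> Wx; rewrite /transF (calGE beta hI sphi Wx). Qed.

Lemma csmooth_transF k : csmooth k S transF.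
Proof.
apply: (csmooth_eq oS (A := fun x => F x - G k x *m Q x *m phi x)).
  by move=> x Wx; rewrite (transFE Wx).
by have := sG k; have := sF k; have := sphi k; have := sQk k => *; smoothness.
Qed.

Arguments csmooth_transF : clear implicits.

Lemma scale_transF k x : (cdom k `&` S) x ->
  ct *: transF x = ct *: (P k x *m F x).
Proof.
move=> Wx; rewrite (transFE Wx) transP.unlock mulmxBl mul1mx !scalerBr; congr (_ - _).
have E : ct *: (Q x *m phi x) = ct *: (Q x *m (adjm ct (G k x) *m F x)).
  by rewrite [RHS]scalemxAr (adjG_F Wx) scalemxAr.
by rewrite -!mulmxA scalemxAr E -scalemxAr.
Qed.

(** The terms D_X G Q phi and G Q (D_X Omega) Q phi combine to
    P (D_X G) Q phi because D_X Omega = G^ D_X G; similarly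
    T X - G Q (D_X phi) = P T X because D_X phi = G^ T X. *)
Lemma dir_transF k X x : (cdom k `&` S) x -> pdir k X transF x =
  P k x *m (T k x *m (X - Phi_mx k X x *m (Q x *m phi x))).
Proof.
move=> Wx; have := sG k; have := sF k; have := sphi k; have := sQk k => *.
rewrite (dir_eq oS X (@transFE k) Wx) (dirB oS)//; [|by smoothness..].
rewrite (dirM (S:=S) (A := fun y => G k y *m Q y))//; [|by smoothness..].
rewrite (dirM (S:=S) (A := G k))// dQ// (red_dOmega (red Wx)) -(jac_mul _ (sphi k) Wx).
rewrite -(adjG_T Wx) dir_chartG_tangent// -(jac_mul _ (sF k) Wx) transP.unlock.
move: (G k x) (T k x) (Phi_mx k X x) => G0 T0 P0; mxnf; mxlin.
Qed.

Lemma transD_mul k x X : (cdom k `&` S) x ->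
  transD k x *m X = X - Phi_mx k X x *m (Q x *m phi x).
Proof.
move=> Wx; rewrite transD.unlock -!mulmxA (jac_mul _ (csmooth_transF k) Wx) dir_transF//.
rewrite (mulmxA (Pd k x)) PdP// mul1mx (mulmxA (adjm _ _)) (metricE hI)// mulKmx//.
exact: (metric_unit hI).
Qed.

Lemma jac_transF k x : (cdom k `&` S) x ->
  jacm k transF x = P k x *m (T k x *m transD k x).
Proof.
move=> Wx; apply: mulmx_cV_inj => X.
by rewrite (jac_mul _ (csmooth_transF k) Wx) dir_transF// -!mulmxA transD_mul.
Qed.

Lemma csmooth_transPd k : csmooth k S (fun x => Pd k x).
Proof.
have := sG k; have := sQk k => *; rewrite transPd.unlock; smoothness.
Qed.

Arguments csmooth_transPd : clear implicits.

Lemma csmooth_transD k : csmooth k S (transD k).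
Proof.
have := sF k; have := csmooth_transF k; have := csmooth_transPd k => *.
have := csmooth_invg (k := k) hI.
rewrite transD.unlock => *; smoothness.
Qed.

Arguments csmooth_transD : clear implicits.

Lemma metric_transF k x : (cdom k `&` S) x ->
  adjm ct (jacm k transF x) *m jacm k transF x = (transD k x)^T *m g k x *m transD k x.
Proof.
move=> Wx; have [_ Sx] := Wx.
rewrite jac_transF// (adj_transP2 (GG Wx) (QtOQ Sx)) adjmM -!mulmxA.
by rewrite (mulmxA (adjm _ _)) (metricE hI).
Qed.

Lemma rank_jac_transF k l x : (cdom k `&` S) x -> cdom l x ->
  (\rank (jacm l transF x) <= \rank (jacm k transF x))%N.
Proof.
move=> [kx Sx] lx.
have -> := jac_change oS (csmooth_transF k) (conj (conj lx kx) Sx).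
exact: mxrankM_maxl.
Qed.

(** P is invertible and T is injective in dF' = P T D. *)
Lemma regular_transD k x : (cdom k `&` S) x ->
  regular_points transF x <-> transD k x \in unitmx.
Proof.
move=> Wx; have [kx Sx] := Wx.
have -> : regular_points transF x <-> \rank (jacm k transF x) = n.
  rewrite /regular_points /= jac_jacm.
  suff -> : \rank (jacm (chart_at x) transF x) = \rank (jacm k transF x) by [].
  apply/eqP; rewrite eqn_leq !rank_jac_transF//; try exact: chart_atP.
  by split => //; exact: chart_atP.
split=> [rk|uD].
  rewrite -row_free_unit -row_leq_rank -[X in (X <= _)%N]rk jac_transF// mulmxA.
  exact: mxrankM_maxr.
apply/eqP; rewrite eqn_leq rank_leq_col /=.
have E : invmx (g k x) *m adjm ct (T k x) *m Pd k x *m jacm k transF x = transD k x.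
  by rewrite transD.unlock !mulmxA.
by rewrite -[X in (X <= _)%N](mxrank_unit uD) -E mxrankM_maxr.
Qed.

Definition transS : set M := S `&` regular_points transF.

Let SS1 : transS `<=` S. Proof. by move=> x []. Qed.

Let W1 k x : (cdom k `&` transS) x -> (cdom k `&` S) x.
Proof. by move=> [kx /SS1]. Qed.

Lemma transD_unit k x : (cdom k `&` transS) x -> transD k x \in unitmx.
Proof. by move=> W1x; have [_ [_ rx]] := W1x; exact/(regular_transD (W1 W1x)). Qed.

Lemma open_transS : open transS.
Proof.
rewrite openE => x [Sx rx].
set k := chart_at x; have kx : cdom k x := chart_atP x.
have Wx : (cdom k `&` S) x by [].
have sdet : smooth_on (cmap k @` (cdom k `&` S)) (fun u => \det (transD k (cinv k u))).
  exact: (smooth_on_det oS (csmooth_transD k)).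
have cdet : {for x, continuous (fun y => \det (transD k (cinv k (cmap k y))))}.
  apply: (@continuous_comp _ _ _ (cmap k) (fun u => \det (transD k (cinv k u)))).
    exact: cmap_continuous.
  apply: differentiable_continuous; apply: (smooth_on_diff sdet).
  by exists x.
have d0 : \det (transD k (cinv k (cmap k x))) != 0.
  by rewrite cmapK// -unitfE -unitmxE; apply/(regular_transD Wx).
have N1 : \forall y \near x, \det (transD k (cinv k (cmap k y))) != 0.
  exact: (cvgr_neq0 _ cdet d0).
have N2 : \forall y \near x, (cdom k `&` S) y.
  by apply: open_nbhs_nbhs; split => //; apply: openI => //; exact: cdom_open.
near=> y.
have Wy : (cdom k `&` S) y by near: y.
have [ky Sy] := Wy; split; first exact: Sy.
apply/(regular_transD Wy).
rewrite unitmxE unitfE -[y in transD k y](cmapK ky).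
by near: y.
Unshelve. all: by end_near. Qed.

(** F' lies in the space form because ct F' = ct P F and P is an isometry. *)
Lemma isometric_transF :
  isometric_immersion transS (induced_metric transF) transF.
Proof.
have gE k x : induced_metric transF k x = adjm ct (jacm k transF x) *m jacm k transF x.
  by rewrite /induced_metric jac_jacm adjmE.
have sF1 k : csmooth k transS transF.
  exact: csmooth_sub SS1 (csmooth_transF k).
split=> //; first exact: open_transS.
- split.
  + move=> k; apply: (csmooth_eq open_transS
      (A := fun x => adjm ct (jacm k transF x) *m jacm k transF x)).
      by move=> x _; rewrite gE.
    by have := sF1 k; have := open_transS => *; smoothness.
  + by move=> k x _; rewrite gE tr_adjmM.
  + move=> k x X Wx X0; have uD := transD_unit Wx.
    case: hI => _ [_ _ pos _] _ _ _.
    have DX0 : transD k x *m X != 0.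
      by apply: contra X0 => /eqP DX; rewrite -(mulKmx uD X) DX mulmx0.
    have := pos k x _ (W1 Wx) DX0.
    by rewrite /gdot gE metric_transF ?trmx_mul ?mulmxA//; exact: W1.
  + move=> k l x [[kx lx] S1x]; have Sx := SS1 S1x.
    rewrite !gE jac_jacm (jac_change oS (csmooth_transF l) (conj (conj kx lx) Sx)).
    by rewrite adjmM !mulmxA.
- move=> x /SS1 Sx ct0.
  pose k := chart_at x; have Wx : (cdom k `&` S) x by split => //; exact: chart_atP.
  have E : transF x = P k x *m F x.
    by apply: (scalerI ct0); exact: scale_transF.
  rewrite /adot adjmE E (adj_transP2 (GG Wx) (QtOQ Sx)).
  by case: hI => _ _ _ /(_ x Sx ct0) + _; rewrite /adot adjmE.
Qed.

Let hI1 := isometric_transF.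
Let oS1 := open_transS.

Local Notation normalG := (normalG F phi beta).

Lemma adjT_normalG k x : (cdom k `&` S) x -> adjm ct (T k x) *m normalG x = 0.
Proof.
move=> Wx; rewrite normalG.unlock mulmxDr (Tbeta Wx) add0r -scalemxAr mulmxA scalemxAl.
by rewrite (position_normal hI)// mul0mx.
Qed.

Lemma nproj_chartG k x : (cdom k `&` S) x -> nproj k g F x *m G k x = normalG x.
Proof.
move=> Wx; rewrite chartG.unlock -addrA mulmxDr mulmxA (nprojT hI)// mul0mx add0r.
have -> : beta x + ct *: (F x *m (phi x)^T) = normalG x by rewrite normalG.unlock.
by rewrite nproj_normal//; exact: adjT_normalG.
Qed.

Lemma dir_position k X x : (cdom k `&` S) x ->
  ct *: (adjm ct (pdir k X (T k) x) *m F x) = - (ct *: (g k x *m X)).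
Proof.
move=> Wx; have sT := csmooth_jac oS (sF k); have := sF k => ?.
have := dir_eq oS X (@position_normal _ _ _ _ _ k _ _ _ hI) Wx.
rewrite dir_cst (dirZ (S:=S))//; last by smoothness.
rewrite (dirM (S:=S))//; last by smoothness.
rewrite (dir_adj ct oS)// -(jac_mul _ (sF k) Wx) mulmxA (metricE hI)//.
by rewrite scalerDr => /eqP; rewrite addr_eq0 => /eqP.
Qed.

Lemma adjT_dbeta k X x : (cdom k `&` S) x ->
  adjm ct (T k x) *m pdir k X beta x =
  g k x *m (Phi_mx k X x *m L) + (c - ct) *: (g k x *m X *m (phi x)^T).
Proof.
move=> Wx; have uk : g k x \in unitmx by apply: (metric_unit hI).
have := red_L1 (red Wx) X; rewrite Phi_mx.unlock => ->.
by rewrite mulmxBr mulKVmx// -scalemxAr !mulmxA subrK.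
Qed.

(** The pairing of beta with the second fundamental form is governed by the
    first condition on L through the derivative of beta, the pairing of F with
    it is - <X, Z>; the constants c - ct and ct add up to c. *)
Lemma normalG_normal_part k X Z x : (cdom k `&` S) x ->
  adjm ct (normalG x) *m (nproj k g F x *m (pdir k X (T k) x *m Z)) =
  - (L^T *m ((Phi_mx k X x)^T *m (g k x *m Z))) - (c * gdot g k x X Z) *: phi x.
Proof.
move=> Wx.
rewrite mulmxA -(adj_nproj hI _ Wx) nproj_normal; last exact: adjT_normalG.
rewrite normalG.unlock adjmD adjmZ adjmM trmxK mulmxDl mulmxA.
have -> : adjm ct (beta x) *m pdir k X (T k) x =
    - (L^T *m (Phi_mx k X x)^T *m g k x) - (c - ct) *: (phi x *m (X^T *m g k x)).
  apply: trmx_inj; rewrite tr_adjmM.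
  rewrite (dir_adjT_normal hI (sbeta k) (@Tbeta k))// adjT_dbeta//.
  rewrite !mx_trE !trmx_mul !trmxK (metric_tr hI)// opprD.
  by rewrite !mulmxA.
have -> : ct *: (phi x *m adjm ct (F x)) *m (pdir k X (T k) x *m Z) =
    - (ct *: (phi x *m (X^T *m g k x *m Z))).
  have E : ct *: (adjm ct (F x) *m pdir k X (T k) x) = - (ct *: (X^T *m g k x)).
    apply: trmx_inj; rewrite linearZ /= tr_adjmM dir_position//.
    by rewrite !mx_trE trmx_mul trmxK (metric_tr hI).
  have -> : ct *: (phi x *m adjm ct (F x)) *m (pdir k X (T k) x *m Z) =
      phi x *m (ct *: (adjm ct (F x) *m pdir k X (T k) x)) *m Z.
    by rewrite -scalemxAl -scalemxAr -scalemxAl !mulmxA.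
  by rewrite E mulmxN mulNmx -scalemxAr -scalemxAl !mulmxA.
rewrite mulmxBl mulNmx -scalemxAl !mulmxA.
have -> : phi x *m X^T *m g k x *m Z = gdot g k x X Z *: phi x.
  by rewrite -!mulmxA (mulmxA X^T) [X^T *m _ *m Z]mx11_scalar mul_mx_scalar.
rewrite !scalerA; mxlin.
Qed.

(** The second condition on L, where ct F is orthogonal to beta and the
    constants c - ct and ct again add up to c. *)
Lemma normalG_sq k x : (cdom k `&` S) x ->
  adjm ct (normalG x) *m normalG x =
  Omega x *m L + L^T *m (Omega x)^T + c *: (phi x *m (phi x)^T).
Proof.
move=> Wx; rewrite (red_L2 (red Wx)) normalG.unlock adjmD adjmZ adjmM trmxK mulmxDl !mulmxDr.
have -> : adjm ct (beta x) *m (ct *: (F x *m (phi x)^T)) = 0.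
  rewrite -scalemxAr mulmxA scalemxAl.
  have -> : ct *: (adjm ct (beta x) *m F x) = 0.
    by apply: trmx_inj; rewrite linearZ /= tr_adjmM (Fbeta Wx) trmx0.
  by rewrite mul0mx.
have -> : ct *: (phi x *m adjm ct (F x)) *m beta x = 0.
  by rewrite -scalemxAl -mulmxA scalemxAr (Fbeta Wx) mulmx0.
have -> : ct *: (phi x *m adjm ct (F x)) *m (ct *: (F x *m (phi x)^T)) =
    ct *: (phi x *m (phi x)^T).
  have -> : ct *: (phi x *m adjm ct (F x)) *m (ct *: (F x *m (phi x)^T)) =
      phi x *m (ct *: (ct *: (adjm ct (F x) *m F x))) *m (phi x)^T.
    by rewrite -?scalemxAl -?scalemxAr -?scalemxAl -?scalemxAr -?scalemxAl !mulmxA.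
  by rewrite (position_sq hI Wx) mul_mx_scalar scalemxAl.
by mxlin.
Qed.

(** As P is an isometry, P^ DP is skew; P G Q^T = - G Q brings the derivative
    to this form. *)
Lemma dir_transP k X x : (cdom k `&` S) x ->
  pdir k X (fun y => P k y) x =
  P k x *m (G k x *m (Q x)^T *m (Phi_mx k X x)^T *m adjm ct (T k x)
            - T k x *m Phi_mx k X x *m Q x *m adjm ct (G k x)).
Proof.
move=> Wx; have [_ Sx] := Wx.
have := sG k; have := sQk k => *.
have := transPPd (GG Wx) (QtOQ Sx); have := transPd_GQ (GG Wx) (QtOQ Sx).
move=> /(congr1 (mulmx (P k x))); rewrite mulmxA => + PPd.
rewrite PPd mul1mx mulmxN => GQ.
rewrite mulmxBr !mulmxA -(mulmxA (P k x) (G k x)).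
rewrite (_ : P k x *m (G k x *m (Q x)^T) = - (G k x *m Q x)); last by rewrite GQ opprK.
rewrite transP.unlock (dirB oS)//; [|by smoothness..].
rewrite dir_cst (dirM (S:=S) (A := fun y => G k y *m Q y))//; [|by smoothness..].
rewrite (dirM (S:=S) (A := G k))// dQ// (red_dOmega (red Wx)) (dir_adj ct oS)// dir_chartG_tangent//.
rewrite adjmM; move: (G k x) (T k x) (Phi_mx k X x) => G0 T0 P0; mxnf; mxlin.
Qed.

Lemma nproj_transP k x a (B : 'M[R]_(N, a)) : (cdom k `&` transS) x ->
  nproj k (induced_metric transF) transF x *m (P k x *m B) =
  P k x *m (nproj k g F x *m B).
Proof.
move=> W1x; have Wx := W1 W1x; have [_ Sx] := Wx; have uD := transD_unit W1x.
have PT : P k x *m T k x = jacm k transF x *m invmx (transD k x).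
  by rewrite jac_transF// !mulmxA mulmxK.
have T0 : adjm ct (T k x) *m (nproj k g F x *m B) = 0.
  by rewrite mulmxA (adjT_nproj hI)// mul0mx.
have BE : B = T k x *m (invmx (g k x) *m adjm ct (T k x) *m B) + nproj k g F x *m B.
  by rewrite nproj.unlock /tproj mulmxBl mul1mx !mulmxA addrC subrK.
rewrite [in LHS]BE !mulmxDr (mulmxA (P k x)) PT -(mulmxA (jacm k transF x)).
rewrite (mulmxA (nproj _ _ _ _) (jacm k transF x)) (nprojT hI1)// mul0mx add0r.
rewrite nproj_normal// jac_transF// (adj_transP2 (GG Wx) (QtOQ Sx)).
by rewrite adjmM -mulmxA T0 mulmx0.
Qed.

(** In the derivative of dF' = P T D the term P T (D_X D) is tangent, and from
    DP only its part with values in G survives. *)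
Lemma normal_part_transF k X Y x : (cdom k `&` transS) x ->
  nproj k (induced_metric transF) transF x *m
    (pdir k X (jacm k transF) x *m Y) =
  P k x *m (nproj k g F x *m (pdir k X (T k) x *m (transD k x *m Y)) +
    normalG x *m ((Q x)^T *m ((Phi_mx k X x)^T *m (g k x *m (transD k x *m Y))))).
Proof.
move=> W1x; have Wx := W1 W1x; have [_ Sx] := Wx.
have sP : csmooth k S (fun y => P k y).
  by have := sG k; have := sQk k => *; rewrite transP.unlock; smoothness.
have sT := csmooth_jac oS (sF k); have sD := csmooth_transD k.
rewrite (dir_eq oS X (@jac_transF k) Wx).
rewrite (dirM (S:=S) (A := fun y => P k y))//; last by smoothness.
rewrite (dirM (S:=S) (A := T k))// dir_transP// -[P k x *m _ *m _]mulmxA -mulmxDr.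
rewrite -(mulmxA (P k x)) nproj_transP//; congr (_ *m _).
rewrite -(nproj_chartG Wx) -[nproj k g F x *m G k x *m _]mulmxA -mulmxDr.
have NT a (B : 'M[R]_(n, a)) : nproj k g F x *m (T k x *m B) = 0.
  by rewrite mulmxA (nprojT hI)// mul0mx.
rewrite -[RHS]add0r -(NT _ (pdir k X (transD k) x *m Y -
  Phi_mx k X x *m Q x *m adjm ct (G k x) *m T k x *m transD k x *m Y)) -mulmxDr.
congr (_ *m _); rewrite -(metricE hI Wx).
by move: (G k x) (T k x) (Phi_mx k X x) (transD k x) => G0 T0 P0 D0; mxnf; mxlin.
Qed.

(** The constant curvature of F is known on pairs X, Y only; for the transform
    it is needed on the quadruple X, Y, D X, D Y. *)
Lemma gauss_polarized k x X Y Z U : (cdom k `&` S) x ->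
  let N X Y := nproj k g F x *m (pdir k X (T k) x *m Y) in
  ip ct (N X Z) (N Y U) - ip ct (N X U) (N Y Z) =
  c * (gdot g k x X Z * gdot g k x Y U - gdot g k x X U * gdot g k x Y Z).
Proof.
move=> Wx N; apply/eqP; rewrite -subr_eq0; apply/eqP.
have NC X' Y' : N X' Y' = N Y' X' by rewrite /N (dir_jac_sym oS _ _ (sF k) Wx).
have ND X' Y' Z' : N (X' + Y') Z' = N X' Z' + N Y' Z'.
  rewrite /N (dirDX (S:=S))//; last exact: csmooth_jac.
  by rewrite (mulmxDl (pdir _ _ _ _)) mulmxDr.
have gC := gdotC hI (x := x) _ _ Wx.
pose E X Y Z U := ip ct (N X Z) (N Y U) - ip ct (N X U) (N Y Z) -
  c * (gdot g k x X Z * gdot g k x Y U - gdot g k x X U * gdot g k x Y Z).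
apply: (curvature_polarization (E := E)); rewrite /E.
- by move=> A B X' Y' Z'; rewrite !ND !ipDl !gdotDl; ring.
- by move=> X' Y' Z' U'; rewrite [ip _ (N Y' _) _]ipC [ip _ (N Y' _) _]ipC; ring.
- move=> X' Y' Z' U'; rewrite (NC Z' X') (NC U' Y') (NC Z' Y') (NC U' X').
  by rewrite (gC Z' X') (gC U' Y') (gC Z' Y') (gC U' X') [ip _ (N Y' Z') _]ipC; ring.
- move=> X' Y' Z' U'.
  rewrite (NC Y' X') (NC Z' X') (NC Z' Y') (gC Y' X') (gC Z' X') (gC Z' Y').
  rewrite (ipC _ (N Y' U') (N X' Z')) (ipC _ (N Z' U') (N X' Y')).
  by rewrite (ipC _ (N Y' Z') (N X' U')); ring.
move=> A B; case: hL => _ /(constant_curvatureE c hI).1/(_ k x A B Wx) + _ _ _.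
rewrite -/(N A A) -/(N B B) -/(N B A) -/(N A B) (ipC _ (N B A)) (gC B A) => ->.
by rewrite expr2 subrr.
Qed.

Lemma curvature_transF : constant_curvature transS (induced_metric transF) c.
Proof.
apply/(constant_curvatureE c hI1) => k x X Y W1x.
have Wx := W1 W1x; have [_ Sx] := Wx.
have ipP A B : ip ct (P k x *m A) (P k x *m B) = ip ct A B.
  by rewrite /ip (adj_transP2 (GG Wx) (QtOQ Sx)).
rewrite (normal_part_transF X X W1x) (normal_part_transF Y Y W1x).
rewrite (normal_part_transF X Y W1x) (normal_part_transF Y X W1x) !ipP.
rewrite !(ip_transformed (normalG_sq Wx) (LQ Sx) (normalG_normal_part _ _ Wx) (normalG_normal_part _ _ Wx)).
have := gauss_polarized X Y (transD k x *m X) (transD k x *m Y) Wx => /= gauss.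
have eE A B : gdot g k x A (transD k x *m B) -
    ((phi x)^T *m ((Q x)^T *m ((Phi_mx k A x)^T *m (g k x *m (transD k x *m B))))) 0 0 =
    gdot (induced_metric transF) k x A B.
  rewrite /gdot.
  have -> : induced_metric transF k x = (transD k x)^T *m g k x *m transD k x.
    by rewrite /induced_metric jac_jacm adjmE metric_transF.
  rewrite -mx_oppE -mx_addE; congr (_ _ 0 0 : R).
  have -> : A^T *m ((transD k x)^T *m g k x *m transD k x) *m B =
     (transD k x *m A)^T *m g k x *m (transD k x *m B) by rewrite trmx_mul !mulmxA.
  rewrite [transD k x *m A]transD_mul// !mx_trE !trmx_mul; mxnf; mxlin.
rewrite !eE (gdotC hI1 Y X W1x); move: gauss.
rewrite [ip ct (nproj k g F x *m (pdir k X _ x *m (transD k x *m Y))) _]ipC; lra.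
Qed.

Section TransformedData.
Context {d : nat} (b : 'M[R]_(m, d)) (Lb : 'M[R]_d).
Hypothesis Lbb : L *m b = b *m Lb.

Local Notation transB := (transB Q Omega b).
Local Notation transC := (transC Q Omega b).

Definition trans_phi x : 'cV[R]_d := (transB x)^T *m phi x.
Definition trans_beta x : 'M[R]_(N, d) :=
  (1%:M - calG g F phi beta x *m Q x *m adj ct (calG g F phi beta x)) *m
  (beta x *m transB x).
Definition trans_Omega x : 'M[R]_d :=
  b^T *m (Omega x - Omega x *m Q x *m Omega x) *m b.

Hypothesis Omega_unit : forall x, S x -> trans_Omega x \in unitmx.

Let tr_transB x : (transB x)^T = b^T - b^T *m Omega x *m Q x.
Proof. by rewrite transB.unlock !mx_trE !trmx_mul !trmxK mulmxA. Qed.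

Lemma trans_betaE k x : (cdom k `&` S) x ->
  trans_beta x = P k x *m (beta x *m transB x).
Proof. by move=> Wx; rewrite /trans_beta (calGE beta hI sphi Wx) adjmE transP.unlock. Qed.

Lemma csmooth_transB k : csmooth k S transB.
Proof. by have := sQk k; have := sOm k => *; rewrite transB.unlock; smoothness. Qed.

Lemma csmooth_trans_phi k : csmooth k S trans_phi.
Proof.
by have := csmooth_transB (k := k); have := sphi k => *; rewrite /trans_phi; smoothness.
Qed.

Lemma csmooth_trans_beta k : csmooth k S trans_beta.
Proof.
apply: (csmooth_eq oS (A := fun x => P k x *m (beta x *m transB x))).
  by move=> x /trans_betaE->.
have := sQk k; have := sbeta k; have := sG k; have := csmooth_transB (k := k) => *.
by rewrite transP.unlock; smoothness.
Qed.

Lemma csmooth_trans_Omega k : csmooth k S trans_Omega.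
Proof. by have := sQk k; have := sOm k => *; rewrite /trans_Omega; smoothness. Qed.

Lemma dir_tr_transB k X x : (cdom k `&` S) x ->
  pdir k X (fun y => b^T - b^T *m Omega y *m Q y) x =
  - (transB x)^T *m pdir k X Omega x *m Q x.
Proof.
move=> Wx; have := sQk k; have := sOm k => *.
rewrite (dirB oS)//; [|by smoothness..].
rewrite dir_cst (dirM (S:=S) (A := fun y => b^T *m Omega y))//; [|by smoothness..].
rewrite (dirMl oS)// dQ// tr_transB; mxnf; mxlin.
Qed.

Lemma dir_transC k X x : (cdom k `&` S) x ->
  pdir k X transC x = - (Q x *m pdir k X Omega x *m transC x).
Proof.
move=> Wx; have := sQk k; have := sOm k => *.
rewrite transC.unlock (dirB oS)//; [|by smoothness..].
rewrite dir_cst (dirMr oS)//; [|by smoothness..].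
rewrite (dirM (S:=S))// dQ//; mxnf; mxlin.
Qed.

(** The derivative of Omega in B^T = b^T (1 - Omega Q) produces
    - B^T G^ T Phi_X Q phi, and d phi = G^ T. *)
Lemma jac_trans_phi k x : (cdom k `&` S) x ->
  jacm k trans_phi x = (transB x)^T *m adjm ct (G k x) *m T k x *m transD k x.
Proof.
move=> Wx; apply: mulmx_cV_inj => X.
have := sQk k; have := sOm k; have := sphi k => *.
rewrite (jac_mul _ (csmooth_trans_phi (k := k)) Wx) -[RHS]mulmxA transD_mul//.
have E y : (cdom k `&` S) y -> trans_phi y = (b^T - b^T *m Omega y *m Q y) *m phi y.
  by rewrite /trans_phi tr_transB.
rewrite (dir_eq oS X E Wx).
rewrite (dirM (S:=S) (A := fun y => b^T - b^T *m Omega y *m Q y))//; [|by smoothness..].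
rewrite dir_tr_transB// (red_dOmega (red Wx)) dir_chartG_tangent// -(jac_mul _ (sphi k) Wx) -(adjG_T Wx).
rewrite tr_transB; mxnf; mxlin.
Qed.

Lemma chartG_split k x : (cdom k `&` S) x -> G k x = tproj k g F x *m G k x + normalG x.
Proof.
by move=> Wx; rewrite -(nproj_chartG Wx) nproj.unlock mulmxBl mul1mx addrC subrK.
Qed.

Lemma transP_chartG k x : (cdom k `&` S) x ->
  P k x *m (G k x *m transB x) = G k x *m transC x.
Proof.
move=> Wx; have [_ Sx] := Wx; have := transP_G (GG Wx) (QOQt Sx).
move=> /(congr1 (mulmx^~ b)); rewrite transB.unlock transC.unlock -!mulmxA !mulmxBl !mul1mx.
by rewrite !mulmxA.
Qed.

(** G' = P G B. With G = tproj G + nu, the tangential part of G' comes from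
    [jac_trans_phi], its normal part from beta' = P beta B and ct F' = ct P F. *)
Lemma chartG_transF k x : (cdom k `&` transS) x ->
  chartG k (induced_metric transF) transF trans_phi trans_beta x =
  G k x *m transC x.
Proof.
move=> W1x; have Wx := W1 W1x; have uD := transD_unit W1x.
have ug : g k x \in unitmx by apply: (metric_unit hI).
have GE : G k x *m transB x = tproj k g F x *m G k x *m transB x + normalG x *m transB x.
  by rewrite {1}(chartG_split Wx) mulmxDl.
rewrite -(transP_chartG Wx) GE.
have -> : chartG k (induced_metric transF) transF trans_phi trans_beta x =
    jacm k transF x *m (invmx (induced_metric transF k x) *m (jacm k trans_phi x)^T)
    + trans_beta x + ct *: (transF x *m (trans_phi x)^T) by rewrite chartG.unlock.
rewrite jac_trans_phi//.
have -> : induced_metric transF k x = (transD k x)^T *m g k x *m transD k x.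
  by rewrite /induced_metric jac_jacm adjmE metric_transF.
have -> : ((transB x)^T *m adjm ct (G k x) *m T k x *m transD k x)^T =
    (transD k x)^T *m (adjm ct (T k x) *m G k x *m transB x).
  rewrite trmx_mul; congr (_ *m _).
  by rewrite -!mulmxA trmx_mul trmxK tr_adjmM mulmxA.
rewrite invmx_congruence// jac_transF// (trans_betaE Wx).
rewrite scalemxAl (scale_transF Wx) /trans_phi trmx_mul trmxK.
rewrite -(mulmxA (P k x)) -(mulmxA (T k x)) mulKVmx// /tproj normalG.unlock.
move: (P k x) (adjm ct (T k x)) (T k x) (G k x) (transB x) => P0 Ta T0 G0 B0.
move: (invmx (g k x)) (F x) (beta x) (phi x) => g0 F0 b0 p0.
by rewrite -?scalemxAr -?scalemxAl; mxnf; rewrite -?scalemxAr -?scalemxAl; mxnf; mxlin.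
Qed.

Lemma dir_chartG_transF k X x : (cdom k `&` transS) x ->
  pdir k X (chartG k (induced_metric transF) transF trans_phi trans_beta) x =
  P k x *m (T k x *m Phi_mx k X x *m transC x).
Proof.
move=> W1x; have Wx := W1 W1x.
have sC : csmooth k S transC.
  by have := sQk k; have := sOm k => *; rewrite transC.unlock; smoothness.
rewrite (dir_eq oS1 X (@chartG_transF k) W1x) (dirM (S:=S))//.
rewrite dir_transC// (red_dOmega (red Wx)) dir_chartG_tangent// transP.unlock.
move: (G k x) (T k x) (Phi_mx k X x) (transC x) => G0 T0 P0 C0; mxnf; mxlin.
Qed.

Lemma Phi_mx_transF k X x : (cdom k `&` transS) x ->
  invmx (induced_metric transF k x) *m (adjm ct (jacm k transF x) *m
    pdir k X (chartG k (induced_metric transF) transF trans_phi trans_beta) x) =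
  invmx (transD k x) *m (Phi_mx k X x *m transC x).
Proof.
move=> W1x; have Wx := W1 W1x; have [_ Sx] := Wx; have uD := transD_unit W1x.
have ug : g k x \in unitmx by apply: (metric_unit hI).
rewrite dir_chartG_transF// jac_transF// (adj_transP2 (GG Wx) (QtOQ Sx)).
have -> : induced_metric transF k x = (transD k x)^T *m g k x *m transD k x.
  by rewrite /induced_metric jac_jacm adjmE metric_transF.
rewrite adjmM -(mulmxA _ (adjm _ _)) invmx_congruence// -(mulmxA (T k x)).
rewrite (mulmxA (adjm _ _)).
by rewrite (metricE hI)// mulKmx.
Qed.

Lemma Phi_mxB k X Y x : (cdom k `&` S) x ->
  Phi_mx k (X - Y) x = Phi_mx k X x - Phi_mx k Y x.
Proof.
move=> Wx; apply/eqP; rewrite eq_sym subr_eq; apply/eqP; rewrite -{1}(subrK Y X).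
rewrite Phi_mx.unlock (dirDX (X - Y) Y (sG k) Wx).
by rewrite !mulmxDr.
Qed.

(** D is the identity minus the map Phi_v for v = Q phi, and the maps Phi_v
    commute. *)
Lemma Phi_mx_transD k X (v : 'cV[R]_m) x : (cdom k `&` S) x ->
  Phi_mx k (transD k x *m X) x *m v = transD k x *m (Phi_mx k X x *m v).
Proof.
move=> Wx; rewrite !transD_mul// Phi_mxB// mulmxBl; congr (_ - _).
by have := red_comm (red Wx) X v (Q x *m phi x); rewrite Phi_mx.unlock => /= ->.
Qed.

Lemma adjT_dtrans_beta k X x : (cdom k `&` S) x ->
  adjm ct (T k x) *m (Pd k x *m pdir k X trans_beta x) =
  - (g k x *m Phi_mx k X x *m Q x *m adjm ct (beta x) *m beta x *m transB x)
  + (g k x *m (Phi_mx k X x *m L) + (c - ct) *: (g k x *m X *m (phi x)^T)) *m transB x.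
Proof.
move=> Wx; have [_ Sx] := Wx.
have sP : csmooth k S (fun y => P k y).
  by have := sG k; have := sQk k => *; rewrite transP.unlock; smoothness.
have sB := csmooth_transB (k := k); have sb := sbeta k.
rewrite (dir_eq oS X (@trans_betaE k) Wx).
rewrite (dirM (S:=S) (A := fun y => P k y))//; last by smoothness.
rewrite (dirM (S:=S) (A := beta))// mulmxDr !(mulmxA (Pd k x)) PdP// mul1mx.
rewrite dir_transP// (mulmxA (Pd k x)) PdP// mul1mx -adjT_dbeta//.
have GB : adjm ct (G k x) *m beta x = adjm ct (beta x) *m beta x.
  rewrite chartG.unlock !adjmD adjmZ !adjmM trmxK !mulmxDl -!mulmxA (Tbeta Wx) mulmx0 add0r.
  by rewrite -scalemxAl -mulmxA scalemxAr (Fbeta Wx) mulmx0 addr0.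
transitivity (adjm ct (T k x) *m G k x *m (Q x)^T *m (Phi_mx k X x)^T *m
    (adjm ct (T k x) *m beta x) *m transB x -
    (adjm ct (T k x) *m T k x) *m Phi_mx k X x *m Q x *m
    (adjm ct (G k x) *m beta x) *m transB x +
    (adjm ct (T k x) *m pdir k X beta x *m transB x +
     (adjm ct (T k x) *m beta x) *m pdir k X transB x)).
  by mxnf.
by rewrite (Tbeta Wx) (metricE hI Wx) GB mulmx0 !mul0mx sub0r addr0 !mulmxA.
Qed.

(** Each condition is the one for F with B and C inserted on the two sides. The
    commutation of the new Phi uses that D^-1 commutes with the old one. *)
Lemma reduced_transF k x : (cdom k `&` transS) x ->
  reduced_data c (induced_metric transF) transF trans_phi trans_beta trans_Omega Lb k x.
Proof.
move=> W1x; have Wx := W1 W1x; have [_ Sx] := Wx; have uD := transD_unit W1x.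
have ug : g k x \in unitmx by apply: (metric_unit hI).
have BC : (transB x)^T *m (Omega x + (Omega x)^T) *m transB x =
    trans_Omega x + (trans_Omega x)^T.
  have E : (transB x)^T *m Omega x *m transB x = trans_Omega x.
    have := OmB_sym (QOQt Sx) => /(congr1 (fun A => b^T *m A *m b)).
    rewrite /trans_Omega => <-; rewrite tr_transB transB.unlock; mxnf; mxlin.
  by rewrite mulmxDr mulmxDl -E !trmx_mul !trmxK !mulmxA.
have EL : (transB x)^T *m Omega x *m L *m transB x = trans_Omega x *m Lb.
  have := OmB_L (LQ Sx) => /(congr1 (fun A => b^T *m A *m b)).
  rewrite /trans_Omega -[_ *m b *m Lb]mulmxA -Lbb => E.
  transitivity (b^T *m ((Omega x - Omega x *m Q x *m Omega x) *m L) *m b).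
    by rewrite -E tr_transB transB.unlock; mxnf; mxlin.
  by rewrite !mulmxA.
split.
- rewrite jac_transF// (trans_betaE Wx) (adj_transP2 (GG Wx) (QtOQ Sx)) adjmM -mulmxA.
  by rewrite (mulmxA (adjm _ _)) (Tbeta Wx) mul0mx mulmx0.
- rewrite scalemxAl -adjmZ (scale_transF Wx) adjmZ -scalemxAl (trans_betaE Wx).
  rewrite (adj_transP2 (GG Wx) (QtOQ Sx)) mulmxA scalemxAl (Fbeta Wx).
  by rewrite mul0mx.
- move=> X; rewrite dir_chartG_transF// nproj_transP// -mulmxA mulmxA.
  by rewrite -(mulmxA (P k x)) (mulmxA (nproj _ _ _ _)) (nprojT hI)// mul0mx mulmx0.
- move=> X u v /=; rewrite !Phi_mx_transF//.
  have K A (w : 'cV[R]_m) : Phi_mx k (invmx (transD k x) *m A) x *m w = invmx (transD k x) *m (Phi_mx k A x *m w).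
    by rewrite -[in RHS](mulKVmx uD A) Phi_mx_transD// mulKmx.
  have cm A (w z : 'cV[R]_m) : Phi_mx k (Phi_mx k A x *m w) x *m z = Phi_mx k (Phi_mx k A x *m z) x *m w.
    by have := red_comm (red Wx) A z w; rewrite Phi_mx.unlock => /= ->.
  have Kv (w z : 'cV[R]_d) : invmx (transD k x) *m (Phi_mx k (invmx (transD k x) *m
      (Phi_mx k X x *m transC x) *m w) x *m transC x) *m z =
      invmx (transD k x) *m (invmx (transD k x) *m
       (Phi_mx k (Phi_mx k X x *m (transC x *m w)) x *m (transC x *m z))).
    by rewrite -!(mulmxA (invmx (transD k x))) -(mulmxA (Phi_mx _ _ _) _ z) K -(mulmxA (Phi_mx k X x)).
  by rewrite !Kv cm.
- exact: Omega_unit.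
- move=> X; rewrite chartG_transF// -(transP_chartG Wx) dir_chartG_transF//.
  rewrite (adj_transP2 (GG Wx) (QtOQ Sx)) adjmM -dir_chartG_tangent//.
  have := sQk k; have := sOm k => *.
  have E y : (cdom k `&` S) y -> trans_Omega y = (b^T - b^T *m Omega y *m Q y) *m Omega y *m b.
    by move=> _; rewrite /trans_Omega; mxnf; mxlin.
  rewrite (dir_eq oS X E Wx) (dirMr oS)//; last by smoothness.
  rewrite (dirM (S:=S))//; last by smoothness.
  rewrite dir_tr_transB// -tr_transB mulmxA -(mulmxA _ (adjm _ _)) -(red_dOmega (red Wx)).
  by rewrite transC.unlock; mxnf; mxlin.
- rewrite chartG_transF// -(transP_chartG Wx) (adj_transP2 (GG Wx) (QtOQ Sx)).
  by rewrite -BC (GG Wx) adjmM !mulmxA.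
- move=> X; rewrite Phi_mx_transF//.
  have -> : induced_metric transF k x = (transD k x)^T *m g k x *m transD k x.
    by rewrite /induced_metric jac_jacm adjmE metric_transF.
  rewrite jac_transF// adj_transP adjmM -(mulmxA _ (Pd k x)) -(mulmxA _ (adjm ct (T k x))).
  rewrite invmx_congruence// adjT_dtrans_beta// -[LHS]mulmxA -(mulmxA (Phi_mx k X x)).
  have gK : invmx (g k x) *m (- (g k x *m Phi_mx k X x *m Q x *m adjm ct (beta x) *m
      beta x *m transB x) + (g k x *m (Phi_mx k X x *m L) +
      (c - ct) *: (g k x *m X *m (phi x)^T)) *m transB x) =
      - (Phi_mx k X x *m Q x *m adjm ct (beta x) *m beta x *m transB x) +
      (Phi_mx k X x *m L + (c - ct) *: (X *m (phi x)^T)) *m transB x.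
    have gKA a (A : 'M[R]_(n, a)) : invmx (g k x) *m (g k x *m A) = A by rewrite mulKmx.
    by rewrite mulmxDr mulmxN -!(mulmxA (g k x)) scalemxAr -mulmxDr -(mulmxA (g k x)) !gKA.
  rewrite gK.
  have rho : adjm ct (beta x) *m beta x = Omega x *m L + L^T *m (Omega x)^T +
      (c - ct) *: (phi x *m (phi x)^T) by rewrite (red_L2 (red Wx)) subrK.
  have key : Phi_mx k X x *m (transC x *m Lb) =
      - (Phi_mx k X x *m Q x *m adjm ct (beta x) *m beta x *m transB x) +
      (Phi_mx k X x *m L + (c - ct) *: (X *m (phi x)^T)) *m transB x -
      (c - ct) *: (transD k x *m X *m (phi x)^T *m transB x).
    have := L_identity (LQ Sx) erefl => /(congr1 (fun A => Phi_mx k X x *m (A *m b))).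
    rewrite mul0mx mulmx0 transD_mul// -(mulmxA (_ *m Q x)) rho.
    have -> : transC x *m Lb = (1%:M - Q x *m Omega x) *m L *m b.
      by rewrite -mulmxA Lbb transC.unlock; mxnf.
    rewrite transB.unlock => H; apply/eqP; rewrite -subr_eq0; apply/eqP; rewrite -{}H.
    by rewrite -?scalemxAr -?scalemxAl; mxnf; rewrite -?scalemxAr -?scalemxAl; mxnf; mxlin.
  rewrite key mulmxBr; congr (_ - _).
  by rewrite -scalemxAr -!mulmxA mulKmx// /trans_phi trmx_mul trmxK.
rewrite (trans_betaE Wx) (adj_transP2 (GG Wx) (QtOQ Sx)) adjmM -EL.
rewrite -[Lb^T *m _](trmx_mul (trans_Omega x) Lb) -EL /trans_phi !trmx_mul !trmxK.
have := red_L2 (red Wx) => /(congr1 (fun A => (transB x)^T *m A *m transB x)).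
mxnf => ->; rewrite -?scalemxAr -?scalemxAl; mxnf.
by [].
Qed.

Lemma L_transform_transF :
  L_transform_data c transS (induced_metric transF) transF
    trans_phi trans_beta trans_Omega Lb.
Proof.
apply: reduced_L_transform; first exact: isometric_transF.
- exact: curvature_transF.
- by move=> k; apply: csmooth_sub SS1 (csmooth_trans_phi (k := k)).
- by move=> k; apply: csmooth_sub SS1 (csmooth_trans_beta (k := k)).
- by move=> k; apply: csmooth_sub SS1 (csmooth_trans_Omega (k := k)).
by move=> k x; exact: reduced_transF.
Qed.

Lemma transform_transF x : transS x ->
  invmx (Omega x) = Q x + transC x *m invmx (trans_Omega x) *m (transB x)^T ->
  transform g F phi beta Omega x =
  transform (induced_metric transF) transF trans_phi trans_beta trans_Omega x.
Proof.
move=> S1x OmV; have [Sx _] := S1x; pose k := chart_at x.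
have W1x : (cdom k `&` transS) x by split=> //; exact: chart_atP.
have Wx := W1 W1x.
have [_ _ [sphi1 _ _ _ _] _ _] := L_transform_transF.
rewrite /transform (calGE beta hI sphi Wx) (calGE trans_beta hI1 sphi1 W1x).
rewrite (chartG_transF W1x) (transFE Wx) OmV /trans_phi; mxnf; mxlin.
Qed.

End TransformedData.
End TransformGeometry.

(** * Block inversion *)
HB.lock Definition blockQ (R : realType) (m q : nat) (Om : 'M[R]_m)
  (a : 'M[R]_(m, q)) : 'M[R]_m := a *m invmx (a^T *m Om *m a) *m a^T.

Section SchurComplement.
Context {R : realType} {m q d : nat} (Om L : 'M[R]_m).
Context (a : 'M[R]_(m, q)) (b : 'M[R]_(m, d)) (La : 'M[R]_q).
Hypothesis bb : b^T *m b = 1%:M.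
Hypothesis ab : a^T *m b = 0.
Hypothesis ab1 : a *m a^T + b *m b^T = 1%:M.
Hypothesis Lbb : L *m a = a *m La.
Hypothesis uOm : Om \in unitmx.
Hypothesis uOa : a^T *m Om *m a \in unitmx.

Local Notation Q := (blockQ Om a).

Lemma blockQ_Om_a : Q *m Om *m a = a.
Proof. by rewrite blockQ.unlock -!mulmxA (mulmxA a^T) mulVmx ?mulmx1. Qed.

Lemma a_Om_blockQ : a^T *m Om *m Q = a^T.
Proof. by rewrite blockQ.unlock !mulmxA mulmxV ?mul1mx. Qed.

Lemma blockQ_OmQt : Q *m Om *m Q^T = Q^T.
Proof.
have -> : Q^T = a *m (invmx (a^T *m Om *m a))^T *m a^T.
  by rewrite blockQ.unlock !trmx_mul trmxK mulmxA.
by rewrite !mulmxA blockQ_Om_a.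
Qed.

Lemma blockQt_OmQ : Q^T *m Om *m Q = Q^T.
Proof.
have -> : Q^T = a *m (invmx (a^T *m Om *m a))^T *m a^T.
  by rewrite blockQ.unlock !trmx_mul trmxK mulmxA.
have -> A : a *m A *m a^T *m Om *m Q = a *m A *m (a^T *m Om *m Q) by rewrite !mulmxA.
by rewrite a_Om_blockQ.
Qed.

(** Q Omega is a projection onto the span of a, which contains the image of
    Q^T and is invariant under L. *)
Lemma blockQ_L : L *m Q^T = Q *m Om *m L *m Q^T.
Proof.
have -> : Q^T = a *m ((invmx (a^T *m Om *m a))^T *m a^T).
  by rewrite blockQ.unlock !trmx_mul trmxK mulmxA.
by rewrite !(mulmxA _ a) -(mulmxA _ L a) Lbb mulmxA blockQ_Om_a.
Qed.

Local Notation schur := (b^T *m (Om - Om *m Q *m Om) *m b).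

Let Om_C : Om *m (b - Q *m Om *m b) = b *m schur.
Proof.
have a0 : a^T *m (Om - Om *m Q *m Om) = 0.
  by rewrite mulmxBr !mulmxA a_Om_blockQ subrr.
transitivity ((a *m a^T + b *m b^T) *m (Om - Om *m Q *m Om) *m b).
  by rewrite ab1 mul1mx mulmxBr mulmxBl !mulmxA.
by rewrite mulmxDl -mulmxA a0 mulmx0 add0r !mulmxA.
Qed.

(** Its inverse is the block b^T Omega^-1 b of the inverse. *)
Lemma schur_unit : schur \in unitmx.
Proof.
suff E : schur *m (b^T *m invmx Om *m b) = 1%:M by have [] := mulmx1_unit E.
have -> : schur *m (b^T *m invmx Om *m b) =
    b^T *m (b *m schur) *m (b^T *m invmx Om *m b) by rewrite (mulmxA b^T b) bb mul1mx.
rewrite -Om_C.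
have -> : b^T *m (Om *m (b - Q *m Om *m b)) *m (b^T *m invmx Om *m b) =
   b^T *m (Om - Om *m Q *m Om) *m (b *m b^T) *m invmx Om *m b by mxnf.
have -> : b *m b^T = 1%:M - a *m a^T by rewrite -ab1 addrAC subrr add0r.
have a0 : (Om - Om *m Q *m Om) *m a = 0.
  by rewrite mulmxBl -!mulmxA (mulmxA Q) blockQ_Om_a subrr.
have -> : b^T *m (Om - Om *m Q *m Om) *m (1%:M - a *m a^T) =
    b^T *m (Om - Om *m Q *m Om) - b^T *m ((Om - Om *m Q *m Om) *m a) *m a^T.
  by rewrite mulmxBr mulmx1 !mulmxA.
rewrite a0 mulmx0 mul0mx subr0.
have -> : b^T *m (Om - Om *m Q *m Om) *m invmx Om *m b =
   b^T *m (1%:M - Om *m Q) *m (Om *m invmx Om) *m b by mxnf.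
rewrite mulmxV// mulmx1 mulmxBr mulmx1 mulmxBl bb.
by rewrite blockQ.unlock -!mulmxA ab !mulmx0 subr0.
Qed.

Lemma invmx_schur : invmx Om =
  Q + (b - Q *m Om *m b) *m invmx schur *m (b^T - b^T *m Om *m Q).
Proof.
set A := RHS; suff E : Om *m A = 1%:M by rewrite -[A](mulKmx uOm) E mulmx1.
rewrite /A mulmxDr !(mulmxA Om) Om_C mulmxK ?schur_unit//.
have -> : Om *m Q = (a *m a^T + b *m b^T) *m Om *m Q by rewrite ab1 mul1mx.
have -> : (a *m a^T + b *m b^T) *m Om *m Q =
   a *m (a^T *m Om *m Q) + b *m b^T *m Om *m Q by mxnf.
by rewrite a_Om_blockQ -ab1; mxnf; mxlin.
Qed.

End SchurComplement.

(** * Restriction to an invariant subspace *)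
Section Restriction.
Context {R : realType} {n p : nat} {c ct : R} {M : manifold R n}.
Local Notation N := (ambient_dim n p ct).
Context (S : set M) (g : metric_field M) (F : M -> 'cV[R]_N).
Context {m : nat} (phi : M -> 'cV[R]_m) (beta : M -> 'M[R]_(N, m)).
Context (Omega : M -> 'M[R]_m) (L : 'M[R]_m).
Hypothesis hL : L_transform_data c S g F phi beta Omega L.
Context {q : nat} (a : 'M[R]_(m, q)) (La : 'M[R]_q).
Hypothesis La_a : L *m a = a *m La.
Hypothesis uOa : forall x, S x -> a^T *m Omega x *m a \in unitmx.

Let phia x := a^T *m phi x.
Let betaa x := beta x *m a.
Let Omegaa x := a^T *m Omega x *m a.

Lemma chartG_restrict k x : (cdom k `&` S) x ->
  chartG k g F phia betaa x = chartG k g F phi beta x *m a.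
Proof.
move=> Wx; case: hL => hI _ [sphi _ _ _ _] _ _; have oS := immersion_open hI.
have -> : chartG k g F phia betaa x = jacm k F x *m (invmx (g k x) *m
    (jacm k phia x)^T) + betaa x + ct *: (F x *m (phia x)^T) by rewrite chartG.unlock.
have -> : jacm k phia x = a^T *m jacm k phi x.
  apply: mulmx_cV_inj => X; have sa : csmooth k S phia.
    by have := sphi k => ?; apply: csmoothM => //; exact: csmooth_cst.
  rewrite (jac_mul _ sa Wx) -mulmxA (jac_mul _ (sphi k) Wx).
  by rewrite /phia (dirMl oS _ _ (sphi k) Wx).
by rewrite chartG.unlock /gradm /phia !trmx_mul !trmxK !mulmxDl -scalemxAl !mulmxA.
Qed.

(** Every condition is linear or bilinear in V, and those with L restrict
    because L a = a La. *)
Lemma L_transform_restrict : L_transform_data c S g F phia betaa Omegaa La.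
Proof.
case: (hL) => hI hc [sphi sbeta sOmega _ _] _ _; have oS := immersion_open hI.
apply: reduced_L_transform => //.
- by move=> k; change (csmooth k S phia); have := sphi k => ?; smoothness.
- by move=> k; change (csmooth k S betaa); have := sbeta k => ?; smoothness.
- by move=> k; change (csmooth k S Omegaa); have := sOmega k => ?; smoothness.
move=> k x Wx; have [kx Sx] := Wx; have r := L_transform_reduced hL Wx.
have sG : csmooth k S (chartG k g F phi beta).
  exact: (csmooth_chartG hI (sphi k) (sbeta k)).
have sb : csmooth k S beta by exact: sbeta.
have sO : csmooth k S Omega by exact: sOmega.
have dG X : pdir k X (chartG k g F phia betaa) x =
    pdir k X (chartG k g F phi beta) x *m a.
  by rewrite (dir_eq oS X (@chartG_restrict k) Wx) (dirMr oS).
split; rewrite ?chartG_restrict//.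
- by rewrite /betaa mulmxA (red_Tbeta r) mul0mx.
- by rewrite /betaa mulmxA scalemxAl (red_Fbeta r) mul0mx.
- by move=> X; rewrite dG mulmxA (red_dG r) mul0mx.
- move=> X u v /=; rewrite !dG.
  have E Y w : invmx (g k x) *m (adjm ct (jacm k F x) *m
      (pdir k Y (chartG k g F phi beta) x *m a)) *m w =
      invmx (g k x) *m (adjm ct (jacm k F x) *m pdir k Y (chartG k g F phi beta) x)
        *m (a *m w) by rewrite !mulmxA.
  by rewrite !E (red_comm r).
- exact: uOa.
- move=> X; rewrite dG adjmM mulmxA -(mulmxA a^T) -(red_dOmega r).
  have sOa : csmooth k S (fun y => a^T *m Omega y).
    by apply: csmoothM => //; exact: csmooth_cst.
  by rewrite /Omegaa (dirMr oS _ _ sOa Wx) (dirMl oS).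
- rewrite adjmM mulmxA -(mulmxA a^T) -(red_Omega r).
  by rewrite /Omegaa !trmx_mul trmxK mulmxDr mulmxDl !mulmxA.
- move=> X; rewrite dG.
  have -> : invmx (g k x) *m (adjm ct (jacm k F x) *m
      (pdir k X (chartG k g F phi beta) x *m a)) *m La =
      invmx (g k x) *m (adjm ct (jacm k F x) *m pdir k X (chartG k g F phi beta) x)
        *m L *m a by rewrite -[RHS]mulmxA La_a !mulmxA.
  rewrite (red_L1 r) /betaa (dirMr oS _ _ sb Wx) /phia trmx_mul trmxK mulmxBl.
  by rewrite -scalemxAl !mulmxA.
have := red_L2 r => /(congr1 (fun A => a^T *m A *m a)).
have -> : a^T *m (Omega x *m L + L^T *m (Omega x)^T) *m a =
    a^T *m Omega x *m (L *m a) + (L *m a)^T *m (Omega x)^T *m a.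
  by rewrite trmx_mul; mxnf.
rewrite La_a /Omegaa /betaa /phia adjmM !trmx_mul !trmxK; mxnf => ->.
by rewrite -?scalemxAr -?scalemxAl; mxnf.
Qed.

End Restriction.

(** * Invertibility of the restriction of Omega *)
Section Positivity.
Context {R : realType} (ct : R) {N : nat}.
Implicit Types u v : 'cV[R]_N.

Let sg (i : 'I_N) : R := if (ct < 0) && (i == 0 :> nat) then -1 else 1.

Lemma ipE u v : ip ct u v = \sum_i sg i * (u i 0 * v i 0).
Proof.
rewrite /ip -adjmE /adj /ambient_gram mxE; apply: eq_bigr => i _.
rewrite mul_mx_diag !mxE; rewrite /sg; ring.
Qed.

Lemma ip_euclidean_eq0 u : 0 <= ct -> ip ct u u = 0 -> u = 0.
Proof.
move=> ct0; rewrite ipE => /eqP; rewrite psumr_eq0; last first.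
  by move=> i _; rewrite /sg ltNge ct0 /= mul1r -expr2 sqr_ge0.
move=> /allP u0; apply/colP => i; rewrite mxE; apply/eqP.
have := u0 i (mem_index_enum i).
by rewrite /sg ltNge ct0 /= mul1r mulf_eq0 orbb.
Qed.

(** The orthogonal complement of a timelike vector is positive definite. *)
Lemma ip_normal_timelike f u : ct < 0 -> ip ct f f < 0 -> ip ct f u = 0 ->
  0 <= ip ct u u /\ (ip ct u u = 0 -> u = 0).
Proof.
move=> ct0 ff fu.
have [i0 i00] : exists i0 : 'I_N, i0 == 0%N :> nat.
  have [i0 _ i00] : exists2 i0, i0 \in 'I_N & i0 == 0%N :> nat.
    apply/exists_inP; apply: contraT => /exists_inPn H.
    suff : 0 <= ip ct f f by rewrite leNgt ff.
    rewrite ipE; apply: sumr_ge0 => i _.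
    by rewrite /sg (negbTE (H i isT)) andbF mul1r -expr2 sqr_ge0.
  by exists i0.
have sg1 i : i != i0 -> sg i = 1.
  move=> ii0; rewrite /sg ifF//; apply/negbTE/nandP; right.
  by apply: contra ii0 => /eqP i0'; apply/eqP/val_inj; rewrite /= i0' (eqP i00).
(* This combination of u and f has no timelike component, so its inner square
   is a sum of squares; by orthogonality it is also a combination of the inner
   squares of u and f. *)
pose z i := f i0 0 * u i 0 - u i0 0 * f i 0.
have z0 : z i0 = 0 by rewrite /z mulrC subrr.
have zE : \sum_i (z i) ^+ 2 = f i0 0 ^+ 2 * ip ct u u + u i0 0 ^+ 2 * ip ct f f.
  transitivity (\sum_i sg i * (z i) ^+ 2).
    apply: eq_bigr => i _; have [->|ii0] := eqVneq i i0.
      by rewrite z0 expr0n/= mulr0.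
    by rewrite sg1// mul1r.
  have -> : f i0 0 ^+ 2 * ip ct u u + u i0 0 ^+ 2 * ip ct f f =
      f i0 0 ^+ 2 * ip ct u u + u i0 0 ^+ 2 * ip ct f f
      - 2 * f i0 0 * u i0 0 * ip ct f u by rewrite fu mulr0 subr0.
  rewrite !ipE !mulr_sumr -big_split -sumrB; apply: eq_bigr => i _ /=.
  rewrite /z; ring.
have f0 : 0 < f i0 0 ^+ 2.
  rewrite lt_def sqr_ge0 andbT; apply: contraTN ff => /eqP f0.
  rewrite -leNgt ipE; apply: sumr_ge0 => i _; have [->|ii0] := eqVneq i i0.
    by rewrite -expr2 f0 mulr0.
  by rewrite sg1// mul1r -expr2 sqr_ge0.
have zz : 0 <= \sum_i (z i) ^+ 2 by apply: sumr_ge0 => i _; exact: sqr_ge0.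
have uf : 0 <= - (u i0 0 ^+ 2 * ip ct f f).
  by rewrite -mulrN mulr_ge0 ?sqr_ge0// oppr_ge0 ltW.
split; first by rewrite -(pmulr_rge0 _ f0); lra.
move=> uu0; rewrite uu0 mulr0 add0r in zE.
have u0 : u i0 0 = 0.
  have /eqP : u i0 0 ^+ 2 * ip ct f f = 0 by lra.
  by rewrite mulf_eq0 (lt_eqF ff) orbF sqrf_eq0 => /eqP.
have : \sum_i (z i) ^+ 2 = 0 by rewrite zE u0 expr0n /= mul0r.
move=> /eqP; rewrite psumr_eq0; last by move=> i _; exact: sqr_ge0.
move=> /allP zi; apply/colP => i; rewrite mxE.
have := zi i (mem_index_enum i); rewrite sqrf_eq0 /z u0 mul0r subr0 mulf_eq0.
by rewrite -[f i0 0 == 0]sqrf_eq0 (gt_eqF f0) => /eqP.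
Qed.

End Positivity.

Section Invertibility.
Context {R : realType} {n p : nat} {c ct : R} {M : manifold R n}.
Local Notation N := (ambient_dim n p ct).
Context (S : set M) (g : metric_field M) (F : M -> 'cV[R]_N).
Context {m : nat} (phi : M -> 'cV[R]_m) (beta : M -> 'M[R]_(N, m)).
Context (Omega : M -> 'M[R]_m) (L : 'M[R]_m).
Hypothesis hL : L_transform_data c S g F phi beta Omega L.
Context {q : nat} (a : 'M[R]_(m, q)) (La : 'M[R]_q).
Hypothesis La_a : L *m a = a *m La.

(** Let w kill a^T Omega a from the left, u = a w and s = <phi, u>. Then
    0 = |G u|^2 = |omega^t u|^2 + |beta u|^2 + ct s^2 and
    |beta u|^2 = (c - ct) s^2. If ct >= 0 the ambient space is Euclidean and
    G u = 0 at once. If ct < 0, the vector beta u is normal to the timelike F,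
    so |beta u|^2 >= 0; then c < ct yields s = 0, while for c > 0 this follows
    from |omega^t u|^2 + c s^2 = 0. In both cases all three parts of G u vanish. *)
Lemma restricted_Omega_unit x : S x -> admissible c ct ->
  (forall v : 'cV[R]_q, calG g F phi beta x *m (a *m v) = 0 -> v = 0) ->
  a^T *m Omega x *m a \in unitmx.
Proof.
move=> Sx adm inj; rewrite unitmxE unitfE; apply/negP => /det0P[w' w0 w'Om].
case: (hL) => hI _ [sphi _ _ _ _] _ _.
pose k := chart_at x; have Wx : (cdom k `&` S) x by split=> //; exact: chart_atP.
have r := L_transform_reduced hL Wx.
have [u uE] : exists u, u = a *m w'^T by exists (a *m w'^T).
pose G := chartG k g F phi beta x.
suff Gu0 : G *m u = 0.
  have w'0 : w'^T = 0 by apply: inj; rewrite (calGE beta hI sphi Wx) -uE.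
  by move/negP: w0; apply; apply/eqP/trmx_inj; rewrite w'0 trmx0.
have uOm : u^T *m Omega x *m a = 0 by rewrite uE trmx_mul trmxK -w'Om !mulmxA.
have GG : ip ct (G *m u) (G *m u) = 0.
  rewrite /ip adjmM -mulmxA (mulmxA (adjm _ _)) -(red_Omega r) mulmxDl mulmxDr.
  have uOu : u^T *m (Omega x *m u) = 0 by rewrite {2}uE !mulmxA uOm mul0mx.
  have -> : u^T *m ((Omega x)^T *m u) = (u^T *m (Omega x *m u))^T.
    by rewrite !trmx_mul trmxK mulmxA.
  by rewrite uOu trmx0 addr0 mxE.
have [ct0|ct0] := leP 0 ct; first exact: ip_euclidean_eq0 ct0 GG.
pose s := (u^T *m phi x) 0 0.
have us : u^T *m phi x = s%:M by rewrite [LHS]mx11_scalar.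
have su : (phi x)^T *m u = s%:M by rewrite -[LHS]tr_mx11 trmx_mul trmxK us.
have sE (e : R) : (e%:M : 'M[R]_1) 0 0 = e by rewrite mxE eqxx mulr1n.
have bb : ip ct (beta x *m u) (beta x *m u) = (c - ct) * s ^+ 2.
  have := red_L2 r => /(congr1 (fun A => u^T *m A *m u)).
  rewrite mulmxDr mulmxDl.
  have uOL : u^T *m (Omega x *m L) *m u = 0.
    by rewrite {2}uE -!mulmxA (mulmxA L) La_a !mulmxA uOm !mul0mx.
  have -> : u^T *m (L^T *m (Omega x)^T) *m u = (u^T *m (Omega x *m L) *m u)^T.
    by rewrite !trmx_mul trmxK !mulmxA.
  rewrite uOL trmx0 addr0 mulmxBr mulmxBl => /esym/eqP; rewrite subr_eq0 => /eqP.
  have -> : u^T *m ((c - ct) *: (phi x *m (phi x)^T)) *m u = ((c - ct) * s ^+ 2)%:M.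
    rewrite -scalemxAr -scalemxAl (mulmxA u^T (phi x)) us -(mulmxA s%:M) su.
    by rewrite -scalar_mxM scale_scalar_mx expr2.
  have -> : u^T *m (adjm ct (beta x) *m beta x) *m u =
      adjm ct (beta x *m u) *m (beta x *m u) by rewrite adjmM !mulmxA.
  by rewrite /ip => ->; rewrite sE.
pose gam := gradm k g phi x *m u.
have gg0 : 0 <= gdot g k x gam gam /\ (gdot g k x gam gam = 0 -> gam = 0).
  have [->|g0] := eqVneq gam 0.
    by split=> //; rewrite /gdot trmx0 !mul0mx mxE.
  have := hI => -[_ [_ _ pos _] _ _ _]; have := pos k x gam Wx g0 => gp.
  by split; [exact: ltW|move=> g00; rewrite g00 ltxx in gp].
have GuE : G *m u = jacm k F x *m gam + (beta x *m u + (ct * s) *: F x).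
  rewrite /G chartG.unlock !mulmxDl -addrA -mulmxA; congr (_ + (_ + _)).
  by rewrite -scalemxAl -mulmxA su mul_mx_scalar scalerA.
have Tb := red_Tbeta r; have Fb := red_Fbeta r.
have ff : ip ct (F x) (F x) = ct^-1.
  have ctn0 : ct != 0 by rewrite lt_eqF.
  by case: hI => _ _ _ /(_ x Sx ctn0) + _; rewrite /adot adjmE.
have Fb0 : ip ct (F x) (beta x *m u) = 0.
  have /eqP := Fb; rewrite scaler_eq0 (lt_eqF ct0) /= => /eqP Fb'.
  by rewrite /ip mulmxA Fb' mul0mx mxE.
have TF : adjm ct (jacm k F x) *m F x = 0.
  by have /eqP := position_normal hI Wx; rewrite scaler_eq0 (lt_eqF ct0) /= => /eqP.
have sum0 : gdot g k x gam gam + ip ct (beta x *m u) (beta x *m u) + ct * s ^+ 2 = 0.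
  have ipDr (A B C : 'cV[R]_N) : ip ct A (B + C) = ip ct A B + ip ct A C.
    by rewrite ipC ipDl !(ipC _ A).
  have ipZ e (A B : 'cV[R]_N) : ip ct (e *: A) B = e * ip ct A B.
    by rewrite /ip adjmZ -scalemxAl mx_scaleE.
  have TA (B : 'cV[R]_N) : adjm ct (jacm k F x) *m B = 0 ->
      ip ct (jacm k F x *m gam) B = 0.
    by move=> TB; rewrite /ip adjmM -mulmxA TB mulmx0 mxE.
  rewrite -GG GuE !ipDl !ipDr !(ipC _ (beta x *m u) (jacm k F x *m gam)).
  rewrite !(ipC _ _ (_ *: F x)) !ipZ !(ipC _ (F x) (_ *: F x)) !ipZ Fb0 ff.
  have Tbu : adjm ct (jacm k F x) *m (beta x *m u) = 0 by rewrite mulmxA Tb mul0mx.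
  rewrite ?(ipC _ (F x) (jacm k F x *m gam)) ?(TA _ TF) ?(TA _ Tbu).
  have -> : ip ct (jacm k F x *m gam) (jacm k F x *m gam) = gdot g k x gam gam.
    by rewrite /ip adjmM -mulmxA (mulmxA (adjm _ _)) (metricE hI Wx) /gdot mulmxA.
  by field; rewrite lt_eqF.
have [bb0 bu0] := ip_normal_timelike (u := beta x *m u) ct0
  (eq_ind_r (fun e => e < 0) (etrans (invr_lt0 ct) ct0) ff) Fb0.
have s20 : 0 <= s ^+ 2 by exact: sqr_ge0.
have [gg1 gg2] := gg0.
have c0 : c < ct \/ 0 < c.
  have [cct|ctc] := ltP c ct; first by left.
  by have [c0|] := leP c 0; [case: adm; rewrite ctc c0|right].
have s0 : s ^+ 2 = 0.
  apply/eqP; rewrite eq_le s20 andbT; case: c0 => c0.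
    by rewrite -(nmulr_rge0 _ (_ : c - ct < 0)) ?subr_lt0// -bb.
  rewrite -(pmulr_rle0 _ c0); move: sum0; rewrite bb; lra.
have s00 : s = 0 by apply/eqP; rewrite -sqrf_eq0 s0.
rewrite s0 mulr0 in bb; rewrite bb s0 !mulr0 !addr0 in sum0.
by rewrite GuE s00 (gg2 sum0) (bu0 bb) mulr0 scale0r mulmx0 !addr0.
Qed.

End Invertibility.

(** * The decomposition theorem *)
Section OrthogonalDecomposition.
Context {R : realType} {m : nat} {d : 'I_2 -> nat} {E : forall j, 'M[R]_(m, d j)}.
Hypothesis hE : orthogonal_decomposition E.

Lemma decomposition_sum i j : i != j -> E j *m (E j)^T + E i *m (E i)^T = 1%:M.
Proof.
move=> ij; case: hE => _ _ <-; rewrite (bigD1 j)//= (bigD1 i)//= big1 ?addr0//.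
by move=> l; case: i j l ij => [[|[|//]] ?] [[|[|//]] ?] [[|[|//]] ?].
Qed.

Lemma decomposition_diag (Lj : forall j, 'M[R]_(d j)) j :
  (\sum_(j < 2) E j *m Lj j *m (E j)^T) *m E j = E j *m Lj j.
Proof.
case: hE => E1 E0 _; rewrite mulmx_suml (bigD1 j)//= big1 => [|i ij].
  by rewrite addr0 -mulmxA E1 mulmx1.
by rewrite -mulmxA E0// mulmx0.
Qed.

End OrthogonalDecomposition.

Theorem theorem31 (R : realType) (n p : nat) (c ct : R) (M : manifold R n)
    (g : metric_field M) (F : M -> 'cV[R]_(ambient_dim n p ct))
    (m : nat) (phi : M -> 'cV[R]_m)
    (beta : M -> 'M[R]_(ambient_dim n p ct, m))
    (Omega : M -> 'M[R]_m) (L : 'M[R]_m)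
    (d : 'I_2 -> nat) (E : forall j : 'I_2, 'M[R]_(m, d j))
    (Lj : forall j : 'I_2, 'M[R]_(d j))
    (hL : L_transform_data c setT g F phi beta Omega L)
    (hE : orthogonal_decomposition E)
    (hLE : L = \sum_(j < 2) E j *m Lj j *m (E j)^T)
    (hD : (admissible c ct /\
           forall (j : 'I_2) (x : M) (v : 'cV[R]_(d j)),
             calG g F phi beta x *m (E j *m v) = 0 -> v = 0) \/
          (forall (j : 'I_2) (x : M), Omega_ E Omega j j x \in unitmx)) :
  forall j : 'I_2,
    let Fj := transform_ E g F phi beta Omega j in
    let Sj := regular_points Fj in
    [/\ forall x : M, Omega_ E Omega j j x \in unitmx,
        L_transform_data c setT g F
          (phi_ E phi j) (beta_ E beta j) (Omega_ E Omega j j) (Lj j) &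
        forall i : 'I_2, i != j ->
          let phib := phi_bar E phi Omega i j in
          let betab := beta_bar E g F phi beta Omega i j in
          let Omegab := Omega_bar E Omega i j in
          let Fij := transform (induced_metric Fj) Fj phib betab Omegab in
          [/\ L_transform_data c Sj (induced_metric Fj) Fj
                phib betab Omegab (Lj i),
              forall x : M, Sj x ->
                transform g F phi beta Omega x = Fij x &
              Sj `&` regular_points (transform g F phi beta Omega) =
              Sj `&` regular_points Fij]].
Proof.
move=> j Fj Sj.
have LE i : L *m E i = E i *m Lj i by rewrite hLE decomposition_diag.
have uj x : Omega_ E Omega j j x \in unitmx.
  case: hD => [[adm inj]|]; last exact.
  by apply: (restricted_Omega_unit hL (LE j)) => // v; exact: inj.
have hj : L_transform_data c setT g F
    (phi_ E phi j) (beta_ E beta j) (Omega_ E Omega j j) (Lj j).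
  by apply: (L_transform_restrict hL (LE j)) => x _; exact: uj.
split; [exact: uj|exact: hj|move=> i ij phib betab Omegab Fij].
pose a := E j; pose b := E i; pose Q x := blockQ (Omega x) a.
have [E1 E0 _] := hE.
have ab : a^T *m b = 0 by apply: E0; rewrite eq_sym.
have bb : b^T *m b = 1%:M by exact: E1.
have ab1 : a *m a^T + b *m b^T = 1%:M by exact: decomposition_sum.
have [hI _ [sphi sbeta sOmega _ data] _ _] := hL.
have uOm x : Omega x \in unitmx.
  by have [] := data (chart_at x) x (conj (chart_atP x) I).
have uOa x : a^T *m Omega x *m a \in unitmx by exact: uj.
have oT : open [set: M] by exact: openT.
have sOmk k : csmooth k setT Omega by exact: sOmega.
have sOa k : csmooth k setT (fun x => a^T *m Omega x *m a) by smoothness.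
have sVk k : csmooth k setT (fun x => invmx (a^T *m Omega x *m a)).
  by apply: csmooth_inv => // x _; exact: uOa.
have sQ : smooth setT Q.
  by move=> k; change (csmooth k setT Q); rewrite /Q blockQ.unlock; smoothness.
have dQ k x X : (cdom k `&` setT) x ->
    pdir k X Q x = - (Q x *m pdir k X Omega x *m Q x).
  move=> Wx; rewrite /Q blockQ.unlock (dirMr oT)//; last by smoothness.
  rewrite (dirMl oT)// (dir_invmx oT X (sOa k) (fun y _ => uOa y) Wx).
  rewrite (dirMr oT)//; last by smoothness.
  by rewrite (dirMl oT)//; mxnf.
have QtOQ x : setT x -> (Q x)^T *m Omega x *m Q x = (Q x)^T.
  by move=> _; exact: blockQt_OmQ.
have QOQt x : setT x -> Q x *m Omega x *m (Q x)^T = (Q x)^T.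
  by move=> _; exact: blockQ_OmQt.
have LQ x : setT x -> L *m (Q x)^T = Q x *m Omega x *m L *m (Q x)^T.
  by move=> _; exact: (blockQ_L (LE j)).
have uS x : setT x -> trans_Omega Omega Q b x \in unitmx.
  by move=> _; exact: (schur_unit bb ab ab1).
have calGj x : calG_ E g F phi beta j x = calG g F phi beta x *m a.
  have Wx : (cdom (chart_at x) `&` setT) x by split=> //; exact: chart_atP.
  have [_ _ [sphij _ _ _ _] _ _] := hj.
  rewrite /calG_ (calGE _ hI sphij Wx) (calGE _ hI sphi Wx).
  exact: (chartG_restrict hL a Wx).
have FjE : Fj = transF g F phi beta Q.
  apply/funext => x; rewrite /Fj /transform_ /transform -/(calG_ E g F phi beta j x).
  by rewrite calGj /transF /Q blockQ.unlock /phi_ /Omega_ !mulmxA.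
have phibE : phib = trans_phi phi Omega Q b.
  apply/funext => x; rewrite /phib /phi_bar /trans_phi transB.unlock /Q blockQ.unlock.
  rewrite /phi_ /Omega_ mx_trD mx_trN mulmxDl !trmx_mul !trmxK mulNmx.
  by rewrite !mulmxA.
have OmegabE : Omegab = trans_Omega Omega Q b.
  apply/funext => x; rewrite /Omegab /Omega_bar /trans_Omega /Q blockQ.unlock.
  by rewrite /Omega_; mxnf.
have betabE : betab = trans_beta g F phi beta Omega Q b.
  apply/funext => x; rewrite /betab /beta_bar /trans_beta /calP calGj.
  rewrite transB.unlock /Q blockQ.unlock !adjmE adjmM /Omega_ /beta_.
  congr (_ *m _); first by rewrite !mulmxA.
  by rewrite mulmxBr !trmx_mul !trmxK !mulmxA.
have SjE : Sj = transS setT g F phi beta Q by rewrite /transS setTI -FjE.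
have hij : L_transform_data c Sj (induced_metric Fj) Fj phib betab Omegab (Lj i).
  rewrite SjE FjE phibE betabE OmegabE.
  exact: (L_transform_transF hL sQ QtOQ QOQt dQ LQ (LE i) uS).
have tE x : Sj x -> transform g F phi beta Omega x = Fij x.
  rewrite /Fij SjE FjE phibE betabE OmegabE => Sx.
  apply: (transform_transF hL sQ QtOQ QOQt dQ LQ (LE i) uS Sx).
  rewrite (invmx_schur bb ab ab1 (uOm x) (uOa x)) transC.unlock transB.unlock.
  by rewrite !mx_trE !trmx_mul !trmxK mulmxA.
split; [exact: hij|exact: tE|].
have oSj : open Sj by rewrite SjE; exact: (open_transS hL sQ QtOQ dQ).
have rE x : Sj x -> jac (chart_at x) (transform g F phi beta Omega) x =
    jac (chart_at x) Fij x.
  move=> Sx; rewrite !jac_jacm; apply: (jac_eq oSj).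
    by move=> y [_ Sy]; exact: tE.
  by split=> //; exact: chart_atP.
by apply/seteqP; split=> x [Sx]; rewrite /regular_points /= rE.
Qed.
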